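(* Let $A$ be a self-adjoint operator with simple discrete spectrum $(\lambda_n)_{n\in I}$ in a separable infinite-dimensional Hilbert space $H$, with $\inf_{n\in I}|\lambda_{n+1}-\lambda_n|=:d>0$. Assume that a sequence $\boldsymbol{\nu}$ of complex numbers can be enumerated as $\nu_n$, $n\in I$, in such a way that the series $$\sum_{n\in I}|\nu_n-\lambda_n|$$ converges. Then there exist vectors $\varphi,\psi\in H$ such that the spectrum of the operator $B=A+\langle\,\cdot\,,\varphi\rangle\psi$, $\operatorname{dom}(B)=\operatorname{dom}(A)$, coincides with $\boldsymbol{\nu}$ counting with multiplicities (that is, the spectrum of $B$ consists of eigenvalues, its elements are exactly the numbers occurring in $\boldsymbol{\nu}$, and the algebraic multiplicity of each eigenvalue equals the number of times it is repeated in $\boldsymbol{\nu}$).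
   Context: $H$ is a complex Hilbert space with scalar product $\langle\cdot,\cdot\rangle$ linear in the first argument. The eigenvalues $\lambda_n$ of $A$ are real and simple and are listed in increasing order, where $I=\mathbb{N}$ if $A$ is bounded below and $I=\mathbb{Z}$ if $A$ is unbounded both below and above (if $A$ is bounded above one replaces $A$ by $-A$, so by convention a semibounded $A$ is bounded below). The algebraic multiplicity of an eigenvalue $\mu$ of $B$ is the dimension of its root subspace $\{y\in \operatorname{dom}(B): (B-\mu)^k y=0 \text{ for some } k\in\mathbb{N}\}$. *)

(* Defs.v *)
From mathcomp Require Export all_boot all_order all_algebra.
From mathcomp Require Export complex.
From mathcomp Require Export all_classical all_reals all_analysis.

Set Implicit Arguments.
Unset Strict Implicit.
Unset Printing Implicit Defensive.

Import Order.TTheory GRing.Theory Num.Theory.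
Import numFieldNormedType.Exports.

Local Open Scope classical_set_scope.
Local Open Scope ring_scope.
Local Open Scope complex_scope.

(* A complex Hilbert space is a complete normed space H over R[i] with a
   positive definite form dot, conjugate-symmetric and linear in its first
   argument, which induces the norm. *)
Definition hilbert_form (R : realType) (H : completeNormedModType R[i])
    (dot : {dot H for (@Num.conj R[i])}) : Prop :=
  forall x : H, dot x x = `|x| ^+ 2.

Section Dimension.
Variables (R : realType) (H : lmodType R[i]).

Definition lin_indep (m : nat) (b : 'I_m -> H) : Prop :=
  forall c : 'I_m -> R[i], \sum_(i < m) c i *: b i = 0 -> forall i, c i = 0.

Definition span_of (m : nat) (b : 'I_m -> H) : set H :=
  [set x | exists c : 'I_m -> R[i], x = \sum_(i < m) c i *: b i].

Definition has_dim (V : set H) (m : nat) : Prop :=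
  exists b : 'I_m -> H, lin_indep b /\ V = span_of b.

Definition infinite_dim : Prop := forall m : nat, ~ has_dim [set: H] m.

End Dimension.

Definition separable (T : topologicalType) : Prop :=
  exists S : set T, countable S /\ dense S.

Section Operators.
Variables (R : realType) (H : completeNormedModType R[i]).

(* A possibly unbounded operator; the values of app outside dom are
   irrelevant. *)
Record operator := Operator { dom : set H ; app :> H -> H }.

Implicit Types (T S : operator) (z mu : R[i]).

Definition linear_op T : Prop :=
  dom T 0 /\
  forall (a : R[i]) (x y : H), dom T x -> dom T y ->
    dom T (a *: x + y) /\ T (a *: x + y) = a *: T x + T y.

Definition op_shift T z : operator :=
  Operator (dom T) (fun x => T x - z *: x).

Definition op_id : operator := Operator setT id.

Definition op_comp S T : operator :=
  Operator [set x | dom T x /\ dom S (T x)] (fun x => S (T x)).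

Fixpoint op_pow T (k : nat) : operator :=
  if k is j.+1 then op_comp T (op_pow T j) else op_id.

Definition resolvent_set T : set R[i] :=
  [set z | set_bij (dom T) [set: H] (op_shift T z) /\
           exists M : R, forall x, dom T x -> `|x| <= M%:C * `|op_shift T z x|].

Definition spectrum T : set R[i] := ~` resolvent_set T.

Definition is_eigenvalue T mu : Prop :=
  exists x, [/\ dom T x, x != 0 & T x = mu *: x].

Definition root_subspace T mu : set H :=
  [set y | dom T y /\
     exists k : nat, dom (op_pow (op_shift T mu) k) y /\
                     op_pow (op_shift T mu) k y = 0].

Definition alg_mult T mu (m : nat) : Prop := has_dim (root_subspace T mu) m.

Definition simple_discrete_spectrum T : Prop :=
  forall z, spectrum T z ->
    [/\ isolated (spectrum T : set R[i]^o) z, is_eigenvalue T z & alg_mult T z 1].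

Variable dot : {dot H for (@Num.conj R[i])}.

(* The graph of the adjoint: y is in dom(T^* ) with T^* y = w. *)
Definition adjoint_graph T (y w : H) : Prop :=
  forall x, dom T x -> dot (T x) y = dot x w.

Definition self_adjoint T : Prop :=
  [/\ linear_op T, dense (dom T) &
      forall y w, adjoint_graph T y w <-> dom T y /\ T y = w].

Definition bounded_below T : Prop :=
  exists m : R, forall x, dom T x -> m%:C * `|x| ^+ 2 <= dot (T x) x.

Definition bounded_above T : Prop :=
  exists m : R, forall x, dom T x -> dot (T x) x <= m%:C * `|x| ^+ 2.

(* Both index sets N and Z are realized as subsets of int, so that sequences
   over I are functions on int of which only the values on I matter. *)
Definition index_set T (I : set int) : Prop :=
  (bounded_below T /\ I = [set n | 0 <= n]) \/
  (~ bounded_below T /\ ~ bounded_above T /\ I = setT).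

Definition rank_one_perturbation T (phi psi : H) : operator :=
  Operator (dom T) (fun x => T x + dot x phi *: psi).

End Operators.

(* Main.v *)
Require Import Defs.
From mathcomp Require Import ring lra.
Import Order.TTheory GRing.Theory Num.Theory.
Import numFieldNormedType.Exports.
Local Open Scope classical_set_scope.
Local Open Scope ring_scope.
Local Open Scope complex_scope.

(* Write l_k for the eigenvalue of A paired with nu_k, and e_k for its unit
   eigenvector.

   Completeness of the eigenvectors e_k of A: on the orthogonal complement N of
   all e_k the inverse T = (A - c)^-1 is bounded and symmetric.  If M > 0 were
   the top of its numerical range on N, then T - M would not be bounded away
   from 0 on N, although T - w is so for w slightly below M and T - M is
   injective on N; the gap below M excludes this.  The same holds for -T, hence
   T = 0 on N.

   Choice of phi and psi: partial fractions of prod_(k < N) (z - nu_k)/(z - l_k)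
   have coefficients converging, as N grows, to some c_k = O(|nu_k - l_k|).
   With phi_k, psi_k square summable, psi_k conj(phi_k) = c_k and phi_k <> 0,
   one gets 1 + <(A - z)^-1 psi, phi> = prod_k (z - nu_k)/(z - l_k).

   Multiplicities: cancelling j of the factors z - nu_k vanishing at mu before
   taking the partial fractions expresses the moments <G^(j+1) psi, phi> (G the
   reduced resolvent of A at mu) as infinite products at mu, so they vanish
   exactly as long as such factors remain.  The vectors G^j psi then form
   a Jordan chain of the perturbed operator of the required length, and it is
   maximal; as all phi_k are nonzero, there is no other chain at mu. *)

Set Implicit Arguments.
Unset Strict Implicit.
Unset Printing Implicit Defensive.

(** The obstacle in the completeness step is an eigenvalue l_k: the hypotheses give no inverse of A
    - l_k, and on N only its injectivity is clear. Hence the argument works with lower bounds |Q x|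
    >= k |x| instead of inverses, and with a gap on one side of M only. The separation d enters the
    perturbation through (nu_k - l_n)/(l_k - l_n) - 1 = (nu_k - l_k)/(l_k - l_n): with B a bound for
    the sums of |nu_k - l_k|, all the products that define the c_n are bounded by the same exp(B/d).
    So (c_n) is absolutely summable, which is what makes it a product of two square summable
    sequences. The moments are the Taylor coefficients at mu of the characteristic product. Each is
    obtained from an algebraic identity between finite products followed by a limit, so no
    derivative or analytic function occurs. If mu is an eigenvalue of A and also occurs among the
    nu_k, the pole of the product cancels one zero. One vanishing moment is then missing, and the
    last vector of the Jordan chain has to be corrected by a multiple of the eigenvector of A at
    mu. *)

Notation normc := Normc.normc.
Notation Re := complex.Re.
Notation Im := complex.Im.

(** * The modulus of complex numbers with values in [R] *)

Section ComplexNorm.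
Variable R : realType.
Implicit Types (x y z : R[i]) (r : R).

Lemma ReD x y : Re (x + y) = Re x + Re y.
Proof. by case: x y => [a b] [c d]. Qed.

Lemma ReN x : Re (- x) = - Re x.
Proof. by case: x. Qed.

Lemma Re_realM r x : Re (r%:C * x) = r * Re x.
Proof. by case: x => a b /=; rewrite mul0r subr0. Qed.

Lemma Re_conj x : Re (Num.conj x) = Re x.
Proof. by case: x. Qed.

Lemma conj_real r : Num.conj r%:C = r%:C :> R[i].
Proof. exact: conjc_real. Qed.

Lemma real_complexB r (s : R) : (r - s)%:C = r%:C - s%:C.
Proof. by rewrite rmorphB. Qed.

Lemma normcE x : `|x| = (normc x)%:C.
Proof. by rewrite normc_def; case: x. Qed.

Lemma normc_ge0 x : 0 <= normc x.
Proof. by case: x => a b; apply: sqrtr_ge0. Qed.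

Lemma normcD x y : normc (x + y) <= normc x + normc y.
Proof. exact: le_normcD. Qed.

Lemma normcN x : normc (- x) = normc x.
Proof. by rewrite -[LHS]/(Re (_%:C)) -[RHS]/(Re (_%:C)) -!normcE normrN. Qed.

Lemma normcB x y : normc (x - y) <= normc x + normc y.
Proof. by rewrite -[normc y]normcN normcD. Qed.

Lemma normc_distC x y : normc (x - y) = normc (y - x).
Proof. by rewrite -opprB normcN. Qed.

Lemma normc_real r : normc r%:C = `|r|.
Proof. by rewrite /= expr0n /= addr0 sqrtr_sqr. Qed.

Lemma normc_conj x : normc (Num.conj x) = normc x.
Proof. by case: x => a b /=; rewrite sqrrN. Qed.

Lemma normc_eq0 x : (normc x == 0) = (x == 0).
Proof.
apply/eqP/eqP => [/Normc.eq0_normc //|->]; exact: Normc.normc0.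
Qed.

Lemma normc_gt0 x : (0 < normc x) = (x != 0).
Proof. by rewrite lt_def normc_ge0 andbT normc_eq0. Qed.

Lemma normcM x y : normc (x * y) = normc x * normc y.
Proof. exact: Normc.normcM. Qed.

Lemma normcV x : normc x^-1 = (normc x)^-1.
Proof. exact: Normc.normcV. Qed.

Lemma normc1 : normc (1 : R[i]) = 1.
Proof. exact: Normc.normc1. Qed.

Lemma normc0 : normc (0 : R[i]) = 0.
Proof. exact: Normc.normc0. Qed.

Lemma normcX x n : normc (x ^+ n) = normc x ^+ n.
Proof.
elim: n => [|n ih]; first by rewrite !expr0 normc1.
by rewrite !exprS normcM ih.
Qed.

Lemma normc_sum (I : Type) (s : seq I) (P : pred I) (F : I -> R[i]) :
  normc (\sum_(i <- s | P i) F i) <= \sum_(i <- s | P i) normc (F i).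
Proof.
elim/big_rec2 : _ => [|i y z _ ih]; first by rewrite normc0.
by rewrite (le_trans (normcD _ _))// lerD2l.
Qed.

Lemma Re_le_normc x : `|Re x| <= normc x.
Proof.
case: x => a b /=; rewrite -sqrtr_sqr ler_wsqrtr// lerDl; exact: sqr_ge0.
Qed.

Lemma Im_le_normc x : `|Im x| <= normc x.
Proof.
case: x => a b /=; rewrite -sqrtr_sqr ler_wsqrtr// lerDr; exact: sqr_ge0.
Qed.

Lemma normc_le_ReIm x : normc x <= `|Re x| + `|Im x|.
Proof.
rewrite {1}(complexE x) (le_trans (normcD _ _))// normcM !normc_real.
by rewrite /= expr0n expr1n /= add0r sqrtr1 mul1r.
Qed.

Lemma mul_conjE x : x * Num.conj x = (normc x ^+ 2)%:C.
Proof. by rewrite -normCK normcE rmorphXn. Qed.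

End ComplexNorm.

(** * The norm of [H] with values in [R] *)

Section HilbertNorm.
Variables (R : realType) (H : completeNormedModType R[i]).
Implicit Types x y z : H.

Definition nrm x : R := Re `|x|.

Lemma nrmE x : `|x| = (nrm x)%:C.
Proof. by rewrite /nrm RRe_real// normr_real. Qed.

Lemma nrm_ge0 x : 0 <= nrm x.
Proof. by rewrite -ler0c -nrmE. Qed.

Lemma nrmD x y : nrm (x + y) <= nrm x + nrm y.
Proof. by rewrite -lecR rmorphD /= -!nrmE ler_normD. Qed.

Lemma nrmN x : nrm (- x) = nrm x.
Proof. by rewrite /nrm normrN. Qed.

Lemma nrmB x y : nrm (x - y) <= nrm x + nrm y.
Proof. by rewrite -[nrm y]nrmN nrmD. Qed.

Lemma nrm_distC x y : nrm (x - y) = nrm (y - x).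
Proof. by rewrite -opprB nrmN. Qed.

Lemma nrmZ (a : R[i]) x : nrm (a *: x) = normc a * nrm x.
Proof. by apply: complexI; rewrite rmorphM /= -!nrmE normrZ normcE. Qed.

Lemma nrm0 : nrm 0 = 0 :> R.
Proof. by rewrite /nrm normr0. Qed.

Lemma nrm_eq0 x : (nrm x == 0) = (x == 0).
Proof. by rewrite -(inj_eq (@complexI R)) -nrmE normr_eq0. Qed.

Lemma nrm_gt0 x : (0 < nrm x) = (x != 0).
Proof. by rewrite lt_def nrm_ge0 andbT nrm_eq0. Qed.

(* The topology of H is that of a module over R[i]; convergence of sequences
   is expressed below through the real-valued distance nrm. *)
Lemma cauchy_nrm (u : nat -> H) :
  (forall eps : R, 0 < eps -> exists N, forall m n, (N <= m <= n)%N ->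
     nrm (u n - u m) <= eps) ->
  exists z, (fun n => nrm (u n - z)) @ \oo --> (0 : R).
Proof.
move=> hu.
have /cauchy_cvg/cvg_ex[z uz] : cauchy (u @ \oo).
  apply/cauchyP => eps eps0.
  have [e epse] : exists e : R, eps = e%:C.
    by apply/complex_realP; apply: gtr0_real.
  rewrite epse in eps0 *.
  have e0 : 0 < e by rewrite -ltcR.
  have [N hN] := hu (e / 2) (divr_gt0 e0 (ltr0Sn R 1)).
  exists (u N); exists N => //= n /= Nn.
  rewrite -ball_normE /= -opprB normrN nrmE ltcR.
  by rewrite (le_lt_trans (hN N n _)) ?leqnn//; lra.
exists z; apply/cvgrPdist_lt => e e0.
have := uz; move=> /cvgrPdist_lt /(_ e%:C); rewrite ltcR => /(_ e0).
apply: filterS => n; rewrite sub0r normrN ger0_norm ?nrm_ge0//.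
by rewrite nrmE ltcR nrm_distC.
Qed.

End HilbertNorm.

Lemma cvg0P (R : realType) (f : nat -> R) :
  f @ \oo --> (0 : R) <->
  forall eps : R, 0 < eps -> exists N, forall n, (N <= n)%N -> `|f n| <= eps.
Proof.
split=> [/cvgrPdist_le h eps e0|h].
  have [N _ hN] := h _ e0.
  by exists N => n Nn; have := hN n Nn; rewrite /= sub0r normrN.
apply/cvgrPdist_le => e e0; have [N hN] := h _ e0.
by exists N => // n Nn; rewrite sub0r normrN; exact: hN.
Qed.

(** * Inner product, bounded symmetric operators, and consequences of a gap *)

Section InnerProduct.
Variables (R : realType) (H : completeNormedModType R[i])
  (dot : {dot H for (@Num.conj R[i])}).
Hypothesis hdot : hilbert_form dot.
Implicit Types (x y z : H) (r : R) (a : R[i]).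

Lemma dotC x y : dot x y = Num.conj (dot y x).
Proof. by rewrite [LHS]hermC mul1r. Qed.

Lemma dotDl x y z : dot (x + y) z = dot x z + dot y z.
Proof. exact: linearDl. Qed.

Lemma dotZl a x z : dot (a *: x) z = a * dot x z.
Proof. exact: linearZl_LR. Qed.

Lemma dotNl x z : dot (- x) z = - dot x z.
Proof. exact: linearNl. Qed.

Lemma dotBl x y z : dot (x - y) z = dot x z - dot y z.
Proof. exact: linearBl. Qed.

Lemma dot0l z : dot 0 z = 0.
Proof. exact: linear0l. Qed.

Lemma dotZr a x z : dot z (a *: x) = Num.conj a * dot z x.
Proof. exact: linearZr_LR. Qed.

Lemma dotBr x y z : dot z (x - y) = dot z x - dot z y.
Proof. exact: linearBr. Qed.

Lemma dot0r z : dot z 0 = 0.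
Proof. exact: linear0r. Qed.

Lemma dot_suml (I : Type) (s : seq I) (P : pred I) (F : I -> H) z :
  dot (\sum_(i <- s | P i) F i) z = \sum_(i <- s | P i) dot (F i) z.
Proof.
by elim/big_rec2 : _ => [|i u v _ ih]; rewrite ?dot0l// dotDl ih.
Qed.

Lemma dotxx x : dot x x = (nrm x ^+ 2)%:C.
Proof. by rewrite hdot nrmE rmorphXn. Qed.

(** Cauchy-Schwarz, from the squared distance of [x] to its projection on the line of [y]. *)
Lemma dot_le_nrm x y : normc (dot x y) <= nrm x * nrm y.
Proof.
have [->|y0] := eqVneq y 0; first by rewrite dot0r normc0 nrm0 mulr0.
have ny0 : 0 < nrm y by rewrite nrm_gt0.
set a := dot x y; set t := nrm y ^+ 2.
have t0 : 0 < t by rewrite exprn_gt0.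
have tC : (t^-1)%:C * t%:C = 1 :> R[i].
  by rewrite -rmorphM /= mulVf ?gt_eqF.
have : dot (x - (a * (t^-1)%:C) *: y) (x - (a * (t^-1)%:C) *: y) =
    (nrm x ^+ 2 - normc a ^+ 2 / t)%:C.
  rewrite dotBl !dotBr !dotZl !dotZr -/a [dot y x]dotC -/a !dotxx -/t.
  rewrite [Num.conj (a * _)]rmorphM /= conj_real.
  rewrite [RHS](_ : _ = (nrm x ^+ 2)%:C - a * Num.conj a * (t^-1)%:C); last first.
    by rewrite mul_conjE -rmorphM -rmorphB.
  transitivity ((nrm x ^+ 2)%:C - 2 * (a * Num.conj a * (t^-1)%:C)
    + (a * Num.conj a) * ((t^-1)%:C * ((t^-1)%:C * t%:C))); first by ring.
  by rewrite tC; ring.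
rewrite dotxx => /complexI h.
have {h} : 0 <= nrm x ^+ 2 - normc a ^+ 2 / t by rewrite -h sqr_ge0.
rewrite subr_ge0 ler_pdivrMr// /t -exprMn.
by rewrite ler_pXn2r// nnegrE ?normc_ge0// mulr_ge0 ?nrm_ge0.
Qed.

Definition dotlE := (dotDl, dotNl, dotZl, dot0l).

Lemma dot_inj x y : (forall z, dot x z = dot y z) -> x = y.
Proof.
move=> xy; apply/eqP; rewrite -subr_eq0 -nrm_eq0 -sqrf_eq0 -(inj_eq (@complexI R)).
by rewrite -dotxx dotBl xy subrr.
Qed.

(** Makes [H] a real inner product space: the completeness argument compares values of quadratic
    forms and needs an ordered codomain. *)
Definition rdot x y : R := Re (dot x y).

Local Notation ip := rdot.

Lemma ipC x y : ip x y = ip y x.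
Proof. by rewrite /rdot dotC Re_conj. Qed.

Lemma ipDl x y z : ip (x + y) z = ip x z + ip y z.
Proof. by rewrite /rdot dotDl ReD. Qed.

Lemma ipZl r x z : ip (r%:C *: x) z = r * ip x z.
Proof. by rewrite /rdot dotZl Re_realM. Qed.

Lemma ipNl x z : ip (- x) z = - ip x z.
Proof. by rewrite /rdot dotNl ReN. Qed.

Lemma ipDr x y z : ip z (x + y) = ip z x + ip z y.
Proof. by rewrite ipC ipDl !(ipC z). Qed.

Lemma ipZr r x z : ip z (r%:C *: x) = r * ip z x.
Proof. by rewrite ipC ipZl (ipC z). Qed.

Lemma ipNr x z : ip z (- x) = - ip z x.
Proof. by rewrite ipC ipNl (ipC z). Qed.

Lemma ipxx x : ip x x = nrm x ^+ 2.
Proof. by rewrite /rdot dotxx. Qed.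

Definition ipE := (ipDl, ipDr, ipNl, ipNr, ipZl, ipZr).

(** Only real scalars occur, in accordance with [rdot], and [Q] stays a total map of [H] so that no
    operator on a subspace has to be built. *)
Record symmetric_on (N : set H) (Q : H -> H) (K : R) : Prop := SymmetricOn {
  sym_stable : forall x, N x -> N (Q x);
  sym_linear : forall r x y, N x -> N y ->
    Q (x + r%:C *: y) = Q x + r%:C *: Q y;
  sym_ip : forall x y, N x -> N y -> ip (Q x) y = ip x (Q y);
  sym_bound : forall x, N x -> nrm (Q x) <= K * nrm x }.

(** Stands in for invertibility on [N]: it composes like invertibility but asks for no range. *)
Definition bounded_away (N : set H) (Q : H -> H) : Prop :=
  exists2 k : R, 0 < k & forall x, N x -> k * nrm x <= nrm (Q x).

Variable N : set H.
Hypothesis N0 : N 0.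
Hypothesis N_lin : forall r x y, N x -> N y -> N (x + r%:C *: y).
Hypothesis N_closed : forall (u : nat -> H) z, (forall n, N (u n)) ->
  (fun n => nrm (u n - z)) @ \oo --> (0 : R) -> N z.

Lemma sym_weaken Q K K' : K <= K' -> symmetric_on N Q K -> symmetric_on N Q K'.
Proof.
move=> KK' [h1 h2 h3 h4]; split=> // x Nx; rewrite (le_trans (h4 _ Nx))//.
by rewrite ler_wpM2r ?nrm_ge0.
Qed.

Lemma sym_scale_shift Q K s t : symmetric_on N Q K ->
  symmetric_on N (fun x => t%:C *: x + s%:C *: Q x) (`|t| + `|s| * K).
Proof.
move=> [h1 h2 h3 h4]; split.
- move=> x Nx; apply: N_lin; last exact: h1.
  by rewrite -[_ *: _]add0r; apply: N_lin.
- move=> r x y Nx Ny; rewrite h2// !scalerDr !scalerA addrACA.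
  by congr (_ + (_ + _)); congr (_ *: _); rewrite mulrC.
- by move=> x y Nx Ny; rewrite !ipE h3.
- move=> x Nx; rewrite (le_trans (nrmD _ _))// !nrmZ !normc_real mulrDl.
  by rewrite lerD2l -mulrA ler_wpM2l// h4.
Qed.

Lemma sym_comp Q K : 0 <= K -> symmetric_on N Q K ->
  symmetric_on N (Q \o Q) (K * K).
Proof.
move=> K0 [h1 h2 h3 h4]; split => /=.
- by move=> x /h1/h1.
- by move=> r x y Nx Ny; rewrite h2// h2//; exact: h1.
- by move=> x y Nx Ny; rewrite !h3//; exact: h1.
- move=> x Nx; rewrite (le_trans (h4 _ (h1 _ Nx)))// -mulrA ler_wpM2l//.
  exact: h4.
Qed.

(** Nonnegativity of the form at [x - K^-1 Q x], where the quadratic term <Q Q x, Q x> is at most K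
    |Q x|^2. *)
Lemma sym_nonneg_norm Q K x : 0 < K -> symmetric_on N Q K ->
  (forall y, N y -> 0 <= ip (Q y) y) -> N x ->
  nrm (Q x) ^+ 2 <= K * ip (Q x) x.
Proof.
move=> K0 [h1 h2 h3 h4] Qge0 Nx.
have := Qge0 (x + (- K^-1)%:C *: Q x) (N_lin _ Nx (h1 _ Nx)).
rewrite h2 ?ipE//; last exact: h1.
rewrite (h3 (Q x) x) ?ipxx//; last exact: h1.
have b1 : ip (Q (Q x)) (Q x) <= K * nrm (Q x) ^+ 2.
  apply: le_trans (ler_norm _) _; apply: le_trans (Re_le_normc _) _.
  apply: le_trans (dot_le_nrm _ _) _; rewrite expr2 mulrA.
  by rewrite ler_wpM2r ?nrm_ge0//; apply/h4/h1.
have b2 : K^-1 * (K^-1 * ip (Q (Q x)) (Q x)) <= K^-1 * nrm (Q x) ^+ 2.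
  rewrite ler_pM2l ?invr_gt0// mulrC ler_pdivrMr// mulrC; exact: b1.
move=> h5; rewrite -ler_pdivrMl//; move: h5 b2.
set v := ip _ _; set n := nrm _ ^+ 2; set w := ip _ _; move=> h5 b2; lra.
Qed.

(** By [sym_nonneg_norm], k^2 |x|^2 <= |Q x|^2 <= K' <Q x, x>; the shift to [K'] only makes the
    bound positive. *)
Lemma sym_coercive Q K : symmetric_on N Q K ->
  (forall y, N y -> 0 <= ip (Q y) y) -> bounded_away N Q ->
  exists2 k : R, 0 < k & forall x, N x -> k * nrm x ^+ 2 <= ip (Q x) x.
Proof.
move=> Qs Qge0 [k k0 hk]; pose K' := `|K| + 1.
have K'0 : 0 < K' by rewrite ltr_pwDr.
have {}Qs : symmetric_on N Q K'.
  apply: sym_weaken Qs; rewrite (le_trans (ler_norm _))// lerDl; exact: ler01.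
exists (k ^+ 2 / K') => [|x Nx]; first by rewrite divr_gt0 ?exprn_gt0.
rewrite mulrAC ler_pdivrMr// mulrC [leRHS]mulrC.
apply: le_trans (sym_nonneg_norm K'0 Qs Qge0 Nx).
rewrite mulrC -exprMn ler_pXn2r ?nnegrE ?nrm_ge0 ?mulr_ge0 ?nrm_ge0 ?(ltW k0)//.
exact: hk.
Qed.

(* With rho^2 the infimum of |S x - (d/2) x|^2 over unit vectors, the operator
   (S - d/2)^2 - rho^2 = (S - d/2 - rho)(S - d/2 + rho) is nonnegative and not
   coercive, so it cannot be bounded away from 0; hence rho >= d/2. *)
Lemma sym_gap S K (d : R) : 0 <= K -> 0 < d -> symmetric_on N S K ->
  (forall w, 0 < w < d -> bounded_away N (fun x => S x - w%:C *: x)) ->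
  forall x, N x -> d * ip (S x) x <= nrm (S x) ^+ 2.
Proof.
move=> K0 d0 Ss gap x Nx.
pose T y := (- (d / 2))%:C *: y + 1%:C *: S y.
(* Completing the square: the claim at [x] says |T x| >= (d/2) |x|, so its failure puts the infimum
   [m] below (d/2)^2. *)
have TS y : nrm (T y) ^+ 2 =
    nrm (S y) ^+ 2 - d * ip (S y) y + (d / 2) ^+ 2 * nrm y ^+ 2.
  by rewrite -!ipxx /T !ipE (ipC y); lra.
rewrite leNgt; apply/negP => hlt.
have nx0 : 0 < nrm x.
  rewrite nrm_gt0; apply/eqP => x0; move: hlt.
  by rewrite x0 /rdot dot0r /= mulr0 ltNge sqr_ge0.
pose E := [set nrm (T y) ^+ 2 / nrm y ^+ 2 | y in [set y | N y /\ 0 < nrm y]].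
have E0 : has_lbound E.
  by exists 0 => _ [y _ <-]; rewrite divr_ge0 ?sqr_ge0.
have Ex : E (nrm (T x) ^+ 2 / nrm x ^+ 2) by exists x.
pose m := inf E.
have m0 : 0 <= m.
  by apply: lb_le_inf; [exists (nrm (T x) ^+ 2 / nrm x ^+ 2)|
     move=> _ [y _ <-]; rewrite divr_ge0 ?sqr_ge0].
have mlt : m < (d / 2) ^+ 2.
  apply: (@le_lt_trans _ _ (nrm (T x) ^+ 2 / nrm x ^+ 2)); first exact: ge_inf.
  by rewrite ltr_pdivrMr ?exprn_gt0// TS; lra.
pose rho := Num.sqrt m.
have rho0 : 0 <= rho by exact: sqrtr_ge0.
have rhom : rho ^+ 2 = m by rewrite sqr_sqrtr.
have rhod : rho < d / 2.
  by rewrite -(@ltr_pXn2r _ 2)// ?nnegrE ?rhom//; lra.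
have Ts := sym_scale_shift 1 (- (d / 2)) Ss; rewrite -/T in Ts.
have K1 : 0 <= `|- (d / 2)| + `|1 : R| * K by rewrite addr_ge0 ?mulr_ge0.
have Qs := sym_scale_shift 1 (- m) (sym_comp K1 Ts).
set Q := (fun _ => _) in Qs.
have Qip y : N y -> ip (Q y) y = nrm (T y) ^+ 2 - m * nrm y ^+ 2.
  move=> Ny; rewrite /Q ipDl !ipZl [(T \o T) y]/= (sym_ip Ts) ?ipxx//; first by ring.
  exact: (sym_stable Ts).
have Qge0 y : N y -> 0 <= ip (Q y) y.
  move=> Ny; rewrite Qip// subr_ge0.
  have [->|y0] := eqVneq y 0; first by rewrite nrm0 expr0n /= mulr0 sqr_ge0.
  rewrite -ler_pdivlMr ?exprn_gt0 ?nrm_gt0//.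
  by apply: ge_inf => //; exists y => //; split=> //; rewrite nrm_gt0.
(* As 0 <= rho < d/2, both roots d/2 - rho and d/2 + rho lie in the gap. *)
have [|k1 k10 hk1] := gap (d / 2 - rho); first by apply/andP; split; lra.
have [|k2 k20 hk2] := gap (d / 2 + rho); first by apply/andP; split; lra.
have Qba : bounded_away N Q.
  exists (k2 * k1) => [|y Ny]; first exact: mulr_gt0.
  pose w := S y - (d / 2 - rho)%:C *: y.
  have Nw : N w.
    rewrite /w -scaleNr -rmorphN; apply: N_lin => //; exact: (sym_stable Ss).
  have -> : Q y = S w - (d / 2 + rho)%:C *: w.
    have lin r u v : N u -> N v -> S (r%:C *: u + v) = r%:C *: S u + S v.
      by move=> Nu Nv; rewrite addrC (sym_linear Ss)// addrC.
    have NS := sym_stable Ss.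
    have e : Q y = S w + (- (d / 2 + rho))%:C *: w.
      have -> : S w = S (S y) + (- (d / 2 - rho))%:C *: S y.
        by rewrite /w -scaleNr -rmorphN (sym_linear Ss)//; exact: NS.
      rewrite /Q /= {1}/T.
      have -> : S (T y) = (- (d / 2))%:C *: S y + S (S y).
        rewrite /T rmorph1 scale1r lin//; exact: NS.
      apply: dot_inj => z; rewrite /T /w !dotlE -rhom; move: (d / 2) => h.
      by rewrite !(rmorphN, rmorphD, rmorphB, rmorphXn, rmorph1) /=; ring.
    by rewrite e rmorphN scaleNr.
  rewrite -mulrA; apply: le_trans (hk2 _ Nw); rewrite ler_pM2l//; exact: hk1.
have [k k0 hk] := sym_coercive Qs Qge0 Qba.
have : m + k <= m.
  apply: lb_le_inf; first by exists (nrm (T x) ^+ 2 / nrm x ^+ 2).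
  move=> _ [y [Ny y0] <-]; rewrite ler_pdivlMr ?exprn_gt0//.
  by have := hk _ Ny; rewrite Qip//; lra.
by lra.
Qed.
End InnerProduct.

(** * Symmetric operators without positive eigenvalues *)

Section NoSpectrum.
Variables (R : realType) (H : completeNormedModType R[i])
  (dot : {dot H for (@Num.conj R[i])}).
Hypothesis hdot : hilbert_form dot.
Implicit Types (x y z : H) (r : R) (a : R[i]).
Local Notation ip := (rdot dot).
Local Notation symmetric_on := (symmetric_on dot).

Variable N : set H.
Hypothesis N0 : N 0.
Hypothesis N_lin : forall r x y, N x -> N y -> N (x + r%:C *: y).
Hypothesis N_closed : forall (u : nat -> H) z, (forall n, N (u n)) ->
  (fun n => nrm (u n - z)) @ \oo --> (0 : R) -> N z.

Lemma expr_cvg0 (q : R) : 0 <= q < 1 -> (fun n => q ^+ n) @ \oo --> (0 : R).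
Proof.
by move=> /andP[q0 q1]; apply: cvg_expr; rewrite ger0_norm.
Qed.

(* On the range of S the gap gives S >= d, so that 1 - S/K contracts there; the
   orbit of y under 1 - S/K converges to a vector of ker S = 0, and summing its
   increments recovers y from S y. *)
Lemma sym_inj_bounded_away S K (d : R) : 0 < d -> symmetric_on N S K ->
  (forall x, N x -> 0 <= ip (S x) x) ->
  (forall x, N x -> d * ip (S x) x <= nrm (S x) ^+ 2) ->
  (forall x, N x -> S x = 0 -> x = 0) -> bounded_away N S.
Proof.
move=> d0 Ss Sge0 Sgap Sinj.
pose L := `|K| + d.
have L0 : 0 < L by rewrite ltr_wpDl.
have {}Ss : symmetric_on N S L.
  by apply: sym_weaken Ss; rewrite (le_trans (ler_norm _))// lerDl ltW.
have dL : d <= L by rewrite lerDr.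
have NS := sym_stable Ss.
(* For u = S y, passing from |u|^2 to |u - L^-1 S u|^2 loses 2/L <S u, u> and regains at most 1/L <S
   u, u> by [sym_nonneg_norm]. As <S u, u> >= d |u|^2, the factor 1 - d/L remains. *)
pose q := Num.sqrt (1 - d / L).
have dL1 : 0 <= 1 - d / L by rewrite subr_ge0 ler_pdivrMr ?mul1r.
have q0 : 0 <= q by exact: sqrtr_ge0.
have qE : q ^+ 2 = 1 - d / L by rewrite sqr_sqrtr.
have q1 : q < 1.
  rewrite -(@ltr_pXn2r _ 2) ?nnegrE// qE expr1n.
  by rewrite ltrBlDr ltrDl divr_gt0.
pose U y := y + (- L^-1)%:C *: S y.
have NU y : N y -> N (U y) by move=> Ny; apply: N_lin => //; exact: NS.
have SU y : N y -> S (U y) = U (S y).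
  by move=> Ny; rewrite /U (sym_linear Ss)//; exact: NS.
(* Nonnegativity at [y - d^-1 S y], combined with the gap inequality at [y]. *)
have SS y : N y -> d * nrm (S y) ^+ 2 <= ip (S (S y)) (S y).
  move=> Ny; have := Sge0 _ (N_lin (- d^-1) Ny (NS _ Ny)).
  rewrite (sym_linear Ss)//; last exact: NS.
  rewrite !ipE (sym_ip Ss (NS _ Ny) Ny) ipxx//.
  have := Sgap _ Ny; have := mulfV (lt0r_neq0 d0).
  set s := ip (S y) y; set n := nrm _ ^+ 2; set w := ip _ _; set e := d^-1.
  move=> de h1 h2.
  have h3 := mulr_ge0 (ltW d0) (mulr_ge0 (ltW d0) h2).
  have h4 : d * (d * (s - 2 * e * n + e * e * w)) =
     d * (d * s) - 2 * d * (d * e) * n + (d * e) ^+ 2 * w by ring.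
  rewrite de in h4.
  have h5 : d * (d * s) <= d * n by rewrite ler_pM2l.
  by lra.
have contr y : N y -> nrm (U (S y)) <= q * nrm (S y).
  move=> Ny; rewrite -(@ler_pXn2r _ 2) ?nnegrE ?nrm_ge0 ?mulr_ge0 ?nrm_ge0//.
  rewrite exprMn qE -!(ipxx hdot) /U !ipE (ipC _ (S (S y)) (S y))//.
  rewrite !(ipxx hdot).
  have := @sym_nonneg_norm _ _ _ hdot _ N_lin _ _ _ L0 Ss Sge0 (NS _ Ny).
  have := SS _ Ny; have := mulfV (lt0r_neq0 L0).
  rewrite (ipC _ (S y))//.
  set s := ip _ _; set n := nrm _ ^+ 2; set w := nrm _ ^+ 2; set e := L^-1.
  move=> Le h1 h2.
  have e0 : 0 < e by rewrite invr_gt0.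
  have h3 : e * w <= s.
    by rewrite mulrC ler_pdivrMr// mulrC.
  have h4 : e * (e * w) <= e * s by rewrite ler_pM2l.
  have h5 : e * (d * n) <= e * s by rewrite ler_pM2l.
  by lra.
have orbN y n : N y -> N (iter n U y) by move=> Ny; elim: n => //= n; exact: NU.
have orbS y n : N y -> nrm (S (iter n U y)) <= q ^+ n * nrm (S y).
  move=> Ny; elim: n => [|n ih] /=; first by rewrite expr0 mul1r.
  have Nn := orbN _ n Ny.
  rewrite SU// (le_trans (contr _ Nn))// exprS -mulrA ler_wpM2l//.
have q1' : 0 < 1 - q by rewrite subr_gt0.
exists (L * (1 - q)) => [|y Ny]; first exact: mulr_gt0.
(* Successive iterates differ by at most L^-1 q^n |S y|. [C] is the sum of this geometric series and
   will bound |y|, whence the constant L (1 - q). *)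
pose C := nrm (S y) / (L * (1 - q)).
have C0 : 0 <= C by rewrite divr_ge0 ?nrm_ge0// mulr_ge0 ?ltW.
rewrite mulrC -ler_pdivlMr ?mulr_gt0// -/C.
have cau m k : nrm (iter (k + m) U y - iter m U y) <= C * (q ^+ m - q ^+ (k + m)).
  elim: k => [|k ih] /=; first by rewrite !subrr nrm0 mulr0.
  rewrite {1}/U addrAC (le_trans (nrmD _ _))//.
  rewrite nrmZ normc_real normrN gtr0_norm ?invr_gt0//.
  have h := orbS y (k + m)%N Ny.
  have : L^-1 * nrm (S (iter (k + m) U y)) <= C * (q ^+ (k + m) - q ^+ (k + m).+1).
    have -> : C * (q ^+ (k + m) - q ^+ (k + m).+1) =
        L^-1 * (q ^+ (k + m) * nrm (S y)).
      by rewrite /C exprS; field; rewrite !gt_eqF.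
    by rewrite ler_pM2l// invr_gt0.
  by rewrite addSn exprS; lra.
have qc : (fun n => q ^+ n) @ \oo --> (0 : R) by apply: expr_cvg0; rewrite q0.
have [z zlim] : exists z, (fun n => nrm (iter n U y - z)) @ \oo --> (0 : R).
  apply: cauchy_nrm => eps eps0.
  have [M hM] := (cvg0P _).1 qc (eps / (C + 1)) (divr_gt0 eps0 (ltr_wpDl C0 ltr01)).
  exists M => m n /andP[Mm mn].
  rewrite -(subnK mn) (le_trans (cau _ _))//.
  have := hM m Mm; rewrite ger0_norm ?exprn_ge0// ler_pdivlMr ?ltr_wpDl//.
  have qm : 0 <= q ^+ m by exact: exprn_ge0.
  have qn : 0 <= C * q ^+ (n - m + m)%N by rewrite mulr_ge0 ?exprn_ge0.
  by lra.
have Nz : N z by apply: N_closed zlim => n; exact: orbN.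
have z0 : z = 0.
  apply: Sinj => //; apply/eqP; rewrite -nrm_eq0 eq_le nrm_ge0 andbT.
  apply/ler_addgt0Pr => eps eps0; rewrite add0r.
  have [M1 h1] := (cvg0P _).1 qc (eps / 2 / (nrm (S y) + 1))
    (divr_gt0 (divr_gt0 eps0 (ltr0Sn R 1)) (ltr_wpDl (nrm_ge0 _) ltr01)).
  have [M2 h2] := (cvg0P _).1 zlim (eps / 2 / L)
    (divr_gt0 (divr_gt0 eps0 (ltr0Sn R 1)) L0).
  pose M := maxn M1 M2.
  have {h1} := h1 M (leq_maxl _ _); have {h2} := h2 M (leq_maxr _ _).
  rewrite !ger0_norm ?nrm_ge0 ?exprn_ge0// !ler_pdivlMr ?ltr_wpDl ?nrm_ge0//.
  move=> h1 h2; have NM := orbN _ M Ny.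
  have -> : S z = S (iter M U y) - S (iter M U y + (-1)%:C *: z).
    rewrite (sym_linear Ss)// opprD addNKr rmorphN rmorph1 scaleN1r opprK//.
  apply: le_trans (nrmB _ _) _.
  have h3 := sym_bound Ss (N_lin (-1) NM Nz).
  rewrite rmorphN rmorph1 scaleN1r in h3 *.
  have h4 := orbS _ M Ny.
  have qM : 0 <= q ^+ M by exact: exprn_ge0.
  by lra.
apply/ler_addgt0Pr => eps eps0.
have [M h] := (cvg0P _).1 zlim eps eps0.
have := h M (leqnn _); rewrite ger0_norm ?nrm_ge0// z0 subr0 => h1.
have := cau 0%N M; rewrite addn0 /= nrm_distC => h2.
have -> : y = (y - iter M U y) + iter M U y by rewrite subrK.
apply: le_trans (nrmD _ _) _.
have : C * (q ^+ 0 - q ^+ M) <= C.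
  by rewrite expr0 ler_piMr// gerBl exprn_ge0.
by lra.
Qed.

(** With [M] the supremum of the form, S = M - T is nonnegative, and a point w in (0, d) for S is
    the point M - w for T. Then [sym_gap] and [sym_inj_bounded_away] bound S away from 0, and
    [sym_coercive] pushes the supremum strictly below [M]. *)
Lemma sym_le0 T K : symmetric_on N T K ->
  (forall w, 0 < w -> forall x, N x -> T x = w%:C *: x -> x = 0) ->
  (forall M, 0 < M -> exists2 d : R, 0 < d &
     forall w, M - d < w < M -> bounded_away N (fun x => T x - w%:C *: x)) ->
  forall x, N x -> ip (T x) x <= 0.
Proof.
move=> Ts Tinj Tgap x Nx; rewrite leNgt; apply/negP => x_gt0.
have nx0 : 0 < nrm x.
  by rewrite nrm_gt0; apply/eqP => x0; move: x_gt0; rewrite x0 /rdot dot0r ltxx.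
pose E := [set ip (T y) y / nrm y ^+ 2 | y in [set y | N y /\ 0 < nrm y]].
have Eub : has_ubound E.
  exists `|K| => _ [y [Ny y0] <-]; rewrite ler_pdivrMr ?exprn_gt0//.
  rewrite (le_trans (ler_norm _))// (le_trans (Re_le_normc _))//.
  rewrite (le_trans (dot_le_nrm _ _ _))// expr2 mulrA ler_wpM2r ?nrm_ge0//.
  rewrite (le_trans (sym_bound Ts Ny))// ler_wpM2r ?nrm_ge0//; exact: ler_norm.
have Ex : E (ip (T x) x / nrm x ^+ 2) by exists x.
pose M := sup E.
have M0 : 0 < M.
  apply: (@lt_le_trans _ _ (ip (T x) x / nrm x ^+ 2)).
    by rewrite divr_gt0 ?exprn_gt0.
  exact: ub_le_sup.
have Ss := sym_scale_shift N0 N_lin (-1) M Ts.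
set S := (fun _ => _) in Ss.
have SE y : S y = M%:C *: y - T y by rewrite /S rmorphN rmorph1 scaleN1r.
have Sip y : ip (S y) y = M * nrm y ^+ 2 - ip (T y) y.
  by rewrite SE !ipE ipxx.
have Sge0 y : N y -> 0 <= ip (S y) y.
  move=> Ny; rewrite Sip subr_ge0.
  have [->|y0] := eqVneq y 0; first by rewrite /rdot dot0r nrm0 expr0n /= mulr0.
  rewrite -ler_pdivrMr ?exprn_gt0 ?nrm_gt0//.
  by apply: ub_le_sup => //; exists y => //; split=> //; rewrite nrm_gt0.
have [d d0 hd] := Tgap M M0.
have Sba : bounded_away N S.
  apply: (@sym_inj_bounded_away S _ d d0 Ss Sge0).
    apply: (@sym_gap _ _ _ hdot _ N0 N_lin _ (`|M| + `|-1| * `|K|)) => //.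
    - by apply: sym_weaken Ss; rewrite lerD2l ler_wpM2l// ler_norm.
    - move=> w /andP[w0 wd].
      have [|k k0 hk] := hd (M - w); first by apply/andP; split; lra.
      exists k => // y Ny; rewrite (le_trans (hk _ Ny))// -nrmN opprB SE.
      by rewrite rmorphB scalerBl addrAC.
  move=> y Ny; rewrite SE => /eqP; rewrite subr_eq0 => /eqP e.
  by apply: (Tinj M).
have [k k0 hk] := sym_coercive hdot N_lin Ss Sge0 Sba.
have : M <= M - k.
  apply: sup_le_ub; first by exists (ip (T x) x / nrm x ^+ 2).
  move=> _ [y [Ny y0] <-]; rewrite ler_pdivrMr ?exprn_gt0//.
  by have := hk _ Ny; rewrite Sip; lra.
by lra.
Qed.

End NoSpectrum.

(** * Eigenvectors of [A] and their completeness *)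

Section Spectrum.
Variables (R : realType) (H : completeNormedModType R[i])
  (dot : {dot H for (@Num.conj R[i])}).
Hypothesis hdot : hilbert_form dot.
Variable A : operator H.
Hypothesis hA : self_adjoint dot A.
Variables (l : nat -> R) (d : R).
Hypothesis d0 : 0 < d.
Hypothesis l_sep : forall j k, j != k -> d <= `|l j - l k|.
Hypothesis hspec : spectrum A = [set (l k)%:C | k in [set: nat]].
Hypothesis hsimple : simple_discrete_spectrum A.
Implicit Types (x y z : H) (r : R) (a mu : R[i]).
Local Notation ip := (rdot dot).

(** At most one eigenvalue different from [mu] lies within d/2 of [mu]; its distance, or else d/2,
    serves as [s]. The point [mu] may be an eigenvalue itself. *)
Lemma punctured_gap mu : exists2 s : R, 0 < s &
  forall k, (l k)%:C != mu -> s <= normc ((l k)%:C - mu).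
Proof.
have [[k0 [k0mu k0d]]|h] :=
  pselect (exists k0, (l k0)%:C != mu /\ normc ((l k0)%:C - mu) < d / 2).
  exists (normc ((l k0)%:C - mu)); first by rewrite normc_gt0 subr_eq0.
  move=> k kmu; have [->//|kk0] := eqVneq k k0.
  have := normcB ((l k)%:C - mu) ((l k0)%:C - mu).
  rewrite opprB addrA subrK -real_complexB normc_real.
  by have := l_sep kk0; lra.
exists (d / 2) => [|k kmu]; first by rewrite divr_gt0.
by rewrite leNgt; apply/negP => kd; apply: h; exists k.
Qed.

Lemma app_linear : linear_op A.
Proof. by case: hA. Qed.

Lemma domD x y : dom A x -> dom A y -> dom A (x + y).
Proof. by move=> dx dy; rewrite -[x]scale1r; have [] := app_linear.2 1 x y dx dy. Qed.

Lemma domZ a x : dom A x -> dom A (a *: x).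
Proof. by move=> dx; rewrite -[_ *: _]addr0; have [] := app_linear.2 a x 0 dx app_linear.1. Qed.

Lemma domB x y : dom A x -> dom A y -> dom A (x - y).
Proof. by move=> dx dy; rewrite -scaleN1r; apply: domD => //; exact: domZ. Qed.

Lemma appD x y : dom A x -> dom A y -> A (x + y) = A x + A y.
Proof.
by move=> dx dy; have [_] := app_linear.2 1 x y dx dy; rewrite !scale1r.
Qed.

Lemma app0 : A 0 = 0.
Proof.
have d00 := app_linear.1; have := appD d00 d00.
by rewrite addr0 => /eqP; rewrite -subr_eq0 opprD addNKr oppr_eq0 => /eqP.
Qed.

Lemma appZ a x : dom A x -> A (a *: x) = a *: A x.
Proof.
move=> dx; have [_] := app_linear.2 a x 0 dx app_linear.1.
by rewrite !addr0 app0 addr0.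
Qed.

Lemma app_sym x y : dom A x -> dom A y -> dot (A x) y = dot x (A y).
Proof.
by move=> dx dy; case: hA => _ _ /(_ y (A y)) [_ h]; exact: (h (conj dy erefl)).
Qed.

Lemma resolvent_pointP mu : (forall k, (l k)%:C != mu) ->
  exists G : H -> H, exists2 M : R, 0 < M &
    [/\ forall y, dom A (G y), forall y, A (G y) - mu *: G y = y,
        forall x, dom A x -> G (A x - mu *: x) = x &
        forall x, dom A x -> nrm x <= M * nrm (A x - mu *: x)].
Proof.
move=> hmu; have : resolvent_set A mu.
  apply: contrapT => nres; have : spectrum A mu by exact: nres.
  by rewrite hspec => -[k _ kmu]; move: (hmu k); rewrite kmu eqxx.
move=> [[/= _ inj surj] [M hM]].
have /choice [G hG] : forall y, exists x, dom A x /\ A x - mu *: x = y.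
  by move=> y; have [x dx xy] := surj y Logic.I; exists x.
exists G; exists (`|M| + 1); first by rewrite ltr_wpDl.
split=> [y|y|x dx|x dx].
- by have [] := hG y.
- by have [] := hG y.
- by have [d1 e1] := hG (A x - mu *: x); apply: inj; rewrite ?inE.
- have := hM x dx; rewrite !nrmE -rmorphM lecR => h; rewrite (le_trans h)//.
  rewrite ler_wpM2r ?nrm_ge0// (le_trans (ler_norm _))// lerDl; exact: ler01.
Qed.

Lemma eigenvalueE mu x : dom A x -> x != 0 -> A x = mu *: x ->
  exists k, (l k)%:C = mu.
Proof.
move=> dx x0 Ax; apply: contrapT => hmu.
have hmu' k : (l k)%:C != mu by apply/eqP => e; apply: hmu; exists k.
have [G [M _ [_ _ _ h]]] := resolvent_pointP hmu'.
move: (h x dx); rewrite Ax subrr nrm0 mulr0 => h0.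
by move: x0; rewrite -nrm_gt0 ltNge h0.
Qed.

Lemma eigenbasis_exists : exists e : nat -> H, forall k,
  [/\ dom A (e k), nrm (e k) = 1, A (e k) = (l k)%:C *: e k &
      forall x, dom A x -> A x = (l k)%:C *: x -> exists a, x = a *: e k].
Proof.
suff /choice [e he] : forall k, exists ek : H, [/\ dom A ek, nrm ek = 1,
    A ek = (l k)%:C *: ek &
    forall x, dom A x -> A x = (l k)%:C *: x -> exists a, x = a *: ek].
  by exists e.
move=> k.
have sk : spectrum A (l k)%:C by rewrite hspec; exists k.
have [_ [x [dx x0 Ax]] [b [b_ind hb]]] := hsimple sk.
have nx0 : 0 < nrm x by rewrite nrm_gt0.
(* Eigenvectors lie in the root subspace, which has dimension 1 by simplicity. *)
have root y : dom A y -> A y = (l k)%:C *: y -> exists a, y = a *: b ord0.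
  move=> dy Ay.
  have : root_subspace A (l k)%:C y.
    split=> //; exists 1%N => /=; split=> //.
    by rewrite Ay subrr.
  by rewrite hb => -[c ->]; exists (c ord0); rewrite big_ord1.
have [a xa] := root x dx Ax.
have a0 : a != 0 by apply: contraNneq x0 => a0; rewrite xa a0 scale0r.
exists ((nrm x)^-1%:C *: x); split.
- exact: domZ.
- by rewrite nrmZ normc_real gtr0_norm ?invr_gt0// mulVf ?gt_eqF.
- by rewrite appZ// Ax !scalerA mulrC.
- move=> y dy Ay; have [a' ->] := root y dy Ay.
  have -> : b ord0 = a^-1 *: x by rewrite xa scalerA mulVf// scale1r.
  exists (a' * a^-1 * (nrm x)%:C); rewrite !scalerA -[in RHS]mulrA.
  by rewrite -[(nrm x)%:C * _]rmorphM mulfV ?gt_eqF// rmorph1 mulr1.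
Qed.

Variable e : nat -> H.
Hypothesis e_spec : forall k,
  [/\ dom A (e k), nrm (e k) = 1, A (e k) = (l k)%:C *: e k &
      forall x, dom A x -> A x = (l k)%:C *: x -> exists a, x = a *: e k].

Lemma e_dom k : dom A (e k). Proof. by have [] := e_spec k. Qed.
Lemma e_nrm k : nrm (e k) = 1. Proof. by have [] := e_spec k. Qed.
Lemma e_eig k : A (e k) = (l k)%:C *: e k. Proof. by have [] := e_spec k. Qed.

Lemma dot_app_e x k : dom A x -> dot (A x) (e k) = (l k)%:C * dot x (e k).
Proof.
by move=> dx; rewrite app_sym// ?e_eig ?dotZr ?conj_real//; exact: e_dom.
Qed.

Lemma e_orthonormal j k : dot (e j) (e k) = (j == k)%:R.
Proof.
have [->|jk] := eqVneq j k; first by rewrite (dotxx hdot) e_nrm expr1n.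
have := dot_app_e k (e_dom j); rewrite e_eig dotZl => /eqP.
rewrite -subr_eq0 -mulrBl mulf_eq0 => /orP[|/eqP//].
rewrite -real_complexB -normc_eq0 normc_real => /eqP h.
by have := l_sep jk; rewrite h leNgt d0.
Qed.

Lemma eigenbasis_complete x : (forall k, dot x (e k) = 0) -> x = 0.
Proof.
pose N := [set x | forall k, dot x (e k) = 0].
rewrite -/(N x).
have N0 : N 0 by move=> k; rewrite dot0l.
have N_lin r u v : N u -> N v -> N (u + r%:C *: v).
  by move=> Nu Nv k; rewrite dotDl dotZl Nu Nv mulr0 addr0.
have N_closed (u : nat -> H) z : (forall n, N (u n)) ->
    (fun n => nrm (u n - z)) @ \oo --> (0 : R) -> N z.
  move=> Nu uz k; apply/eqP; rewrite -normc_eq0 eq_le normc_ge0 andbT.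
  apply/ler_addgt0Pr => eps eps0; rewrite add0r.
  have [n hn] := (cvg0P _).1 uz eps eps0.
  have := hn n (leqnn _); rewrite ger0_norm ?nrm_ge0//; apply: le_trans.
  have -> : dot z (e k) = - dot (u n - z) (e k) by rewrite dotBl Nu sub0r opprK.
  by rewrite normcN (le_trans (dot_le_nrm hdot _ _))// e_nrm mulr1.
(* A point off all eigenvalues by the separation, and real, so that T = (A - c)^-1 is symmetric. *)
pose c := l 0%N + d / 2.
have lc k : l k != c.
  apply/eqP => kc; have [k0|k0] := eqVneq k 0%N.
    by move: kc; rewrite k0 /c; have := d0; lra.
  have := l_sep k0; rewrite kc /c.
  have -> : l 0%N + d / 2 - l 0%N = d / 2 by ring.
  by rewrite ger0_norm ?divr_ge0 ?(ltW d0)//; have := d0; lra.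
clearbody c.
have [T [M M0 [Tdom TK KT Tb]]] : exists T : H -> H, exists2 M : R, 0 < M &
    [/\ forall y, dom A (T y), forall y, A (T y) - c%:C *: T y = y,
        forall x, dom A x -> T (A x - c%:C *: x) = x &
        forall x, dom A x -> nrm x <= M * nrm (A x - c%:C *: x)].
  by apply: resolvent_pointP => k; rewrite (inj_eq (@complexI R)).
have Tlin r u v : T (u + r%:C *: v) = T u + r%:C *: T v.
  have dT : dom A (T u + r%:C *: T v) by apply: domD => //; exact: domZ.
  rewrite -(KT _ dT) appD//; last exact: domZ.
  rewrite appZ//; congr T; rewrite -{1}(TK u) -{1}(TK v).
  by apply: (dot_inj hdot) => z; rewrite !dotlE; ring.
have symA u v : dom A u -> dom A v ->
    dot (A u - c%:C *: u) v = dot u (A v - c%:C *: v).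
  by move=> du dv; rewrite dotBl dotBr dotZl dotZr conj_real app_sym.
have NT u : N u -> N (T u).
  move=> Nu k.
  have : (l k - c)%:C * dot (T u) (e k) = 0.
    rewrite -(Nu k) -{2}(TK u) dotBl dotZl dot_app_e// real_complexB; ring.
  by move/eqP; rewrite mulf_eq0 (inj_eq (@complexI R) _ 0) subr_eq0 (negPf (lc k)) => /eqP.
have Ts : symmetric_on dot N T M.
  split=> //.
  - by move=> u v _ _; rewrite /rdot -{1}(TK v) -symA// TK.
  - by move=> u _; rewrite -{2}(TK u); exact: Tb.
(* For w <> 0 such a [u] is an eigenvector of [A] at c + 1/w, hence a multiple of some [e k], to
   which it is also orthogonal. *)
have Tinj w u : N u -> T u = w%:C *: u -> u = 0.
  move=> Nu Tu; have [w0|w0] := eqVneq w 0.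
    by rewrite -(TK u) Tu w0 scale0r app0 scaler0 subrr.
  have wC : w%:C != 0 :> R[i] by rewrite (inj_eq (@complexI R) _ 0).
  have du : dom A u.
    rewrite -[u]scale1r -(mulVf wC) -scalerA -Tu; exact: domZ.
  have Au : A u = (c%:C + w%:C^-1) *: u.
    rewrite scalerDl -{3}(TK u) Tu appZ// !scalerA scalerBr !scalerA.
    by rewrite mulVf// mulrCA mulVf// mulr1 scale1r addrC subrK.
  apply: contrapT => /eqP u0; have [k kE] := eigenvalueE du u0 Au.
  have [_ _ _ /(_ u du)] := e_spec k; rewrite kE => /(_ Au) [a ua].
  have := Nu k; rewrite ua dotZl e_orthonormal eqxx mulr1 => a0.
  by move: u0; rewrite ua a0 scale0r eqxx.
(* T - w = - w (A - (c + 1/w)) T, so where c + 1/w is a resolvent point |T u - w u| controls first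
   |T u| and then |w u|. *)
have Tba w : w != 0 -> (forall k, l k != c + w^-1) ->
    bounded_away N (fun u => T u - w%:C *: u).
  move=> w0 hw.
  have wC : w%:C != 0 :> R[i] by rewrite (inj_eq (@complexI R) _ 0).
  have [_ [K K0 [_ _ _ hK]]] : exists G : H -> H, exists2 M : R, 0 < M &
    [/\ forall y, dom A (G y), forall y, A (G y) - (c + w^-1)%:C *: G y = y,
        forall x, dom A x -> G (A x - (c + w^-1)%:C *: x) = x &
        forall x, dom A x -> nrm x <= M * nrm (A x - (c + w^-1)%:C *: x)].
    by apply: resolvent_pointP => k; rewrite (inj_eq (@complexI R)).
  have nw : 0 < `|w| by rewrite normr_gt0.
  have K1 : 0 < K / `|w| + 1 by rewrite ltr_wpDl// divr_ge0// ltW.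
  exists (`|w| / (K / `|w| + 1)) => [|u Nu]; first by rewrite divr_gt0.
  set y := T u - w%:C *: u.
  have yE : y = (- w%:C) *: (A (T u) - (c + w^-1)%:C *: T u).
    rewrite /y -{2}(TK u) rmorphD fmorphV /=.
    apply: (dot_inj hdot) => z; rewrite !dotlE.
    have := mulfV wC; set wi := _^-1 => e1.
    transitivity ((w%:C * wi) * dot (T u) z - w%:C * (dot (A (T u)) z - c%:C * dot (T u) z)).
      by rewrite e1; ring.
    by ring.
  have h1 : nrm (T u) <= K / `|w| * nrm y.
    rewrite yE nrmZ normcN normc_real mulrA divfK ?gt_eqF//; exact: hK.
  have h2 : `|w| * nrm u <= (K / `|w| + 1) * nrm y.
    rewrite -normc_real -nrmZ.
    have -> : w%:C *: u = T u - y by rewrite /y opprB addrC subrK.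
    by rewrite (le_trans (nrmB _ _))// mulrDl mul1r lerD2r normc_real.
  by rewrite mulrAC ler_pdivrMr// [leRHS]mulrC.
(* A gap of length [s] above 1/M' becomes, under inversion, a gap below M' of length M' - 1/(1/M' +
   s); the nested difference matches the form in which [sym_le0] asks for it. *)
have invw (M' s w : R) : 0 < M' -> 0 < s -> M' - (M' - (M'^-1 + s)^-1) < w < M' ->
    [/\ 0 < w, M'^-1 < w^-1 & w^-1 < M'^-1 + s].
  move=> M'0 s0; rewrite subKr => /andP[w1 w2].
  have q0 : 0 < M'^-1 + s by rewrite addr_gt0 ?invr_gt0.
  have w0 : 0 < w by rewrite (lt_trans _ w1)// invr_gt0.
  split=> //; first by rewrite ltf_pV2.
  by rewrite -[ltRHS]invrK ltf_pV2// posrE invr_gt0.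
have dpos (M' s : R) : 0 < M' -> 0 < s -> 0 < M' - (M'^-1 + s)^-1.
  move=> M'0 s0; rewrite subr_gt0 -[ltRHS]invrK ltf_pV2 ?posrE ?invr_gt0//.
    by rewrite ltrDl.
  by rewrite addr_gt0 ?invr_gt0.
have gapR t : exists2 s : R, 0 < s & forall k, l k != t -> s <= `|l k - t|.
  have [s s0 hs] := punctured_gap t%:C; exists s => // k kt.
  by rewrite -normc_real real_complexB hs// (inj_eq (@complexI R)).
(* c + 1/M' may be an eigenvalue of [A]; only the interval just below M' can be cleared, and
   [sym_le0] asks for no more. *)
have Tle u : N u -> ip (T u) u <= 0.
  apply: (sym_le0 hdot N0 N_lin N_closed Ts) => [w _ v Nv|M' M'0]; first exact: Tinj.
  have [s s0 hs] := gapR (c + M'^-1).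
  exists (M' - (M'^-1 + s)^-1) => [|w /(invw _ _ _ M'0 s0) [w0 w1 w2]].
    exact: dpos.
  apply: Tba => [|k]; first by rewrite gt_eqF.
  apply/eqP => kE; have := hs k; rewrite kE => h.
  have : s <= `|c + w^-1 - (c + M'^-1)| by apply: h; rewrite gt_eqF// ltrD2l.
  by rewrite ger0_norm; lra.
have Tge u : N u -> 0 <= ip (T u) u.
  have Ts' := sym_scale_shift N0 N_lin (-1) 0 Ts.
  set T' := (fun _ => _) in Ts'.
  have T'E v : T' v = - T v by rewrite /T' scale0r add0r rmorphN rmorph1 scaleN1r.
  move=> Nu; rewrite -oppr_le0 -ipNl -T'E; move: u Nu.
  apply: (sym_le0 hdot N0 N_lin N_closed Ts') => [w _ v Nv|M' M'0].
    by rewrite T'E => e1; apply: (Tinj (- w)) => //; rewrite rmorphN scaleNr -e1 opprK.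
  have [s s0 hs] := gapR (c - M'^-1).
  exists (M' - (M'^-1 + s)^-1) => [|w /(invw _ _ _ M'0 s0) [w0 w1 w2]].
    exact: dpos.
  have [|k|k k0 hk] := Tba (- w); first by rewrite oppr_eq0 gt_eqF.
    apply/eqP => kE; have := hs k; rewrite kE invrN => h.
    have : s <= `|c - w^-1 - (c - M'^-1)| by apply: h; rewrite lt_eqF//; lra.
    by rewrite ler0_norm; lra.
  exists k => // v Nv; rewrite (le_trans (hk _ Nv))// -nrmN T'E rmorphN scaleNr.
  by rewrite opprK opprD.
move=> Nx.
have := sym_nonneg_norm hdot N_lin M0 Ts Tge Nx.
have -> : ip (T x) x = 0 by apply/eqP; rewrite eq_le Tle// Tge.
rewrite mulr0 => h.
have : nrm (T x) ^+ 2 == 0 by rewrite eq_le h sqr_ge0.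
rewrite sqrf_eq0 nrm_eq0 => /eqP Tx.
by apply: (Tinj 0) => //; rewrite Tx scale0r.
Qed.

End Spectrum.

(** * Limits of real and complex sequences *)

Section Sequences.
Variable R : realType.
Implicit Types (u v : nat -> R[i]) (z w : R[i]).

Lemma bounded_mono_cauchy (S : nat -> R) (B : R) :
  (forall m n, (m <= n)%N -> S m <= S n) -> (forall n, S n <= B) ->
  forall eps : R, 0 < eps ->
    exists N, forall m n, (N <= m <= n)%N -> S n - S m <= eps.
Proof.
move=> Smono SB eps eps0.
have hs : has_sup (range S).
  by split; [exists (S 0%N), 0%N|exists B => _ [n _ <-]].
have [_ [N _ <-] hN] := sup_adherent eps0 hs.
exists N => m n /andP[Nm mn].
have := Smono _ _ Nm; have : S n <= sup (range S).
  by apply: ub_le_sup; [exact: hs.2|exists n].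
by lra.
Qed.

Lemma squeeze0 (f g : nat -> R) : (forall n, `|f n| <= g n) ->
  g @ \oo --> (0 : R) -> f @ \oo --> (0 : R).
Proof.
move=> fg /cvg0P g0; apply/cvg0P => eps /g0[N hN]; exists N => n Nn.
by rewrite (le_trans (fg n))// (le_trans (ler_norm _))// hN.
Qed.

Lemma cvg0_le0 (f : nat -> R) (b : R) : (forall n, b <= f n) ->
  f @ \oo --> (0 : R) -> b <= 0.
Proof.
move=> bf /cvg0P f0; apply/ler_addgt0Pr => eps /f0[N hN]; rewrite add0r.
by rewrite (le_trans (bf N))// (le_trans (ler_norm _))// hN.
Qed.

Lemma cvg0D (f g : nat -> R) : f @ \oo --> (0 : R) -> g @ \oo --> (0 : R) ->
  (fun n => f n + g n) @ \oo --> (0 : R).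
Proof. by move=> hf hg; rewrite -[0]addr0; exact: cvgD. Qed.

Lemma cvg0Mr (f : nat -> R) c : f @ \oo --> (0 : R) ->
  (fun n => f n * c) @ \oo --> (0 : R).
Proof. by move=> hf; rewrite -(mul0r c); apply: cvgM => //; exact: cvg_cst. Qed.

(* R[i] carries no normed-module topology here, so complex limits are phrased
   through the real modulus. *)
Definition ccvg u z : Prop := (fun n => normc (u n - z)) @ \oo --> (0 : R).

Lemma ccvg_cst z : ccvg (fun=> z) z.
Proof.
by apply/cvg0P => eps eps0; exists 0%N => n _; rewrite subrr normc0 normr0 ltW.
Qed.

Lemma ccvg_ext u v z N : (forall n, (N <= n)%N -> u n = v n) ->
  ccvg u z -> ccvg v z.
Proof.
move=> uv /cvg0P h; apply/cvg0P => eps /h[M hM]; exists (maxn M N) => n.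
by rewrite geq_max => /andP[Mn Nn]; rewrite -uv// hM.
Qed.

Lemma ccvg_unique u z w : ccvg u z -> ccvg u w -> z = w.
Proof.
move=> uz uw; apply/eqP; rewrite -subr_eq0 -normc_eq0 eq_le normc_ge0 andbT.
apply: (cvg0_le0 _ (cvg0D uz uw)) => n.
rewrite (_ : z - w = (u n - w) - (u n - z)); last by ring.
by rewrite [leRHS]addrC normcB.
Qed.

Lemma ccvgD u v z w : ccvg u z -> ccvg v w -> ccvg (fun n => u n + v n) (z + w).
Proof.
move=> uz vw; have := cvg0D uz vw; apply: squeeze0 => n /=.
rewrite ger0_norm ?normc_ge0// (_ : _ - _ = (u n - z) + (v n - w)); last by ring.
exact: normcD.
Qed.

Lemma ccvgMl c u z : ccvg u z -> ccvg (fun n => c * u n) (c * z).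
Proof.
move=> uz; have := cvg0Mr (normc c) uz.
apply: squeeze0 => n /=; by rewrite ger0_norm ?normc_ge0// -mulrBr normcM mulrC.
Qed.

Lemma ccvg_normc_le u z (B : R) N : (forall n, (N <= n)%N -> normc (u n) <= B) ->
  ccvg u z -> normc z <= B.
Proof.
move=> uB /cvg0P h; apply/ler_addgt0Pr => eps /h[M hM].
have := hM (maxn M N) (leq_maxl _ _); have := uB (maxn M N) (leq_maxr _ _).
rewrite ger0_norm ?normc_ge0// => h1 h2.
rewrite (_ : z = u (maxn M N) - (u (maxn M N) - z)); last by ring.
by rewrite (le_trans (normcB _ _))// lerD.
Qed.

Lemma ccvg_normc_ge u z (B : R) N : (forall n, (N <= n)%N -> B <= normc (u n)) ->
  ccvg u z -> B <= normc z.
Proof.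
move=> uB /cvg0P h; apply/ler_addgt0Pr => eps /h[M hM].
have := hM (maxn M N) (leq_maxl _ _); have := uB (maxn M N) (leq_maxr _ _).
rewrite ger0_norm ?normc_ge0// => h1 h2; rewrite (le_trans h1)//.
rewrite (_ : u _ = z + (u (maxn M N) - z)); last by ring.
by rewrite (le_trans (normcD _ _))// lerD.
Qed.

(** The increments of the real and imaginary parts are dominated by [b], so completeness of [R]
    applies to each part. *)
Lemma ccvg_of_increments u (b : nat -> R) (B : R) :
  (forall n, normc (u n.+1 - u n) <= b n) ->
  (forall n, \sum_(0 <= k < n) b k <= B) -> exists z, ccvg u z.
Proof.
move=> ub bB.
have real_cvg (f : nat -> R) : (forall n, `|f n.+1 - f n| <= b n) ->
    exists z : R, (fun n => `|f n - z|) @ \oo --> (0 : R).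
  move=> fb.
  have fcau m k : `|f (k + m)%N - f m| <=
      \sum_(0 <= i < k + m) b i - \sum_(0 <= i < m) b i.
    elim: k => [|k ih]; first by rewrite !subrr normr0.
    rewrite addSn big_nat_recr//=.
    rewrite (_ : _ - f m = (f (k + m).+1 - f (k + m)) + (f (k + m) - f m)); last by ring.
    by rewrite (le_trans (ler_normD _ _))// -addrA [leRHS]addrCA lerD.
  have : cauchy (f @ \oo).
    apply/cauchyP => eps eps0.
    have Smono m n : (m <= n)%N -> \sum_(0 <= i < m) b i <= \sum_(0 <= i < n) b i.
      move=> mn; rewrite [leRHS](big_cat_nat (leq0n _) mn)//= lerDl sumr_ge0// => i _.
      exact: le_trans (normc_ge0 _) (ub i).
    have [N hN] := bounded_mono_cauchy Smono bB (divr_gt0 eps0 (ltr0Sn R 1)).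
    exists (f N); exists N => //= n /= Nn; rewrite /ball /= distrC.
    rewrite -(subnK Nn) (le_lt_trans (fcau _ _))// subnK//.
    by have := hN N n; rewrite leqnn => /(_ Nn); lra.
  move=> /cauchy_cvg/cvg_ex[/= z fz]; exists z.
  apply/cvg0P => eps eps0; have /cvgrPdist_le/(_ _ eps0)[N _ hN] := fz.
  by exists N => n Nn; rewrite normr_id distrC; exact: hN.
have ImB p q : Im (p - q) = Im p - Im q :> R by case: p q => [? ?] [? ?].
have [|x hx] := real_cvg (fun n => Re (u n)).
  by move=> n; rewrite -ReN -ReD (le_trans (Re_le_normc _)).
have [|y hy] := real_cvg (fun n => Im (u n)).
  by move=> n; rewrite -ImB (le_trans (Im_le_normc _)).
exists (x +i* y); have := cvg0D hx hy; apply: squeeze0 => n /=.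
by rewrite ger0_norm ?normc_ge0// (le_trans (normc_le_ReIm _))// ReD ReN ImB.
Qed.

End Sequences.

(** * Expansions in a complete orthonormal sequence *)

Section OrthonormalBasis.
Variables (R : realType) (H : completeNormedModType R[i])
  (dot : {dot H for (@Num.conj R[i])}).
Hypothesis hdot : hilbert_form dot.
Variable e : nat -> H.
Hypothesis e_on : forall j k, dot (e j) (e k) = (j == k)%:R.
Hypothesis e_complete : forall x, (forall k, dot x (e k) = 0) -> x = 0.
Implicit Types (x y z : H) (a : nat -> R[i]).

Lemma coord_inj x y : (forall k, dot x (e k) = dot y (e k)) -> x = y.
Proof.
move=> xy; apply/eqP; rewrite -subr_eq0; apply/eqP/e_complete => k.
by rewrite dotBl xy subrr.
Qed.

Lemma dot_sum_e a m n j : dot (\sum_(m <= k < n) a k *: e k) (e j) =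
  if (m <= j < n)%N then a j else 0.
Proof.
rewrite dot_suml; under eq_bigr do rewrite dotZl e_on.
case: ifPn => h.
  rewrite (bigD1_seq j) ?mem_index_iota ?iota_uniq//= eqxx mulr1.
  by rewrite big1 ?addr0// => k /negPf ->; rewrite mulr0.
rewrite big_nat big1// => k mkn; case: eqP h mkn => [-> /negPf ->//|_ _ _].
by rewrite mulr0.
Qed.

Lemma nrm_sum_e a m n : nrm (\sum_(m <= k < n) a k *: e k) ^+ 2 =
  \sum_(m <= k < n) normc (a k) ^+ 2.
Proof.
apply: complexI; rewrite -(dotxx hdot) {1}dot_suml rmorph_sum /=.
rewrite big_nat [RHS]big_nat; apply: eq_bigr => k mkn.
by rewrite dotZl dotC dot_sum_e mkn mul_conjE.
Qed.

Lemma nrm_orth_sum x a n : (forall k, dot x (e k) = a k) ->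
  nrm (x - \sum_(0 <= k < n) a k *: e k) ^+ 2 =
  nrm x ^+ 2 - \sum_(0 <= k < n) normc (a k) ^+ 2.
Proof.
move=> xa; set s := \sum_(_ <= _ < _) _.
have xs : dot x s = (\sum_(0 <= k < n) normc (a k) ^+ 2)%:C.
  rewrite dotC dot_suml rmorph_sum rmorph_sum /=; apply: eq_bigr => k _.
  by rewrite dotZl [dot (e k) x]dotC xa mul_conjE conj_real.
apply: complexI; rewrite -(dotxx hdot) dotBl !dotBr [dot s x]dotC xs.
by rewrite !(dotxx hdot) nrm_sum_e conj_real subrr subr0 rmorphB.
Qed.

Lemma bessel x n : \sum_(0 <= k < n) normc (dot x (e k)) ^+ 2 <= nrm x ^+ 2.
Proof. by rewrite -subr_ge0 -nrm_orth_sum// sqr_ge0. Qed.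

(** Squared norms of blocks of the series are increments of a bounded monotone sequence, so the
    partial sums are Cauchy. The explicit bound on [nrm x] is what later gives bounded operators. *)
Lemma riesz_fischer a (B : R) :
  (forall n, \sum_(0 <= k < n) normc (a k) ^+ 2 <= B ^+ 2) -> 0 <= B ->
  exists x, [/\ forall k, dot x (e k) = a k, nrm x <= B &
    (fun n => nrm (\sum_(0 <= k < n) a k *: e k - x)) @ \oo --> (0 : R)].
Proof.
move=> aB B0.
have Smono m n : (m <= n)%N -> \sum_(0 <= i < m) normc (a i) ^+ 2 <=
    \sum_(0 <= i < n) normc (a i) ^+ 2.
  by move=> mn; rewrite [leRHS](big_cat_nat (leq0n _) mn)//= lerDl sumr_ge0// => i _;
    exact: sqr_ge0.
have [x xlim] : exists x,
    (fun n => nrm (\sum_(0 <= k < n) a k *: e k - x)) @ \oo --> (0 : R).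
  apply: cauchy_nrm => eps eps0.
  have [N hN] := bounded_mono_cauchy Smono aB (exprn_gt0 2 eps0).
  exists N => m n Nmn; have /andP[Nm mn] := Nmn.
  rewrite (big_cat_nat (leq0n _) mn)//= addrAC subrr add0r.
  rewrite -(@ler_pXn2r _ 2) ?nnegrE ?nrm_ge0 ?(ltW eps0)// nrm_sum_e.
  apply: le_trans (hN _ _ Nmn); rewrite [X in X - _](big_cat_nat (leq0n _) mn)//=.
  by rewrite addrAC subrr add0r.
exists x; split=> // [k|].
  apply: (@ccvg_unique _ (fun n => dot (\sum_(0 <= k < n) a k *: e k) (e k))).
    move: xlim; apply: squeeze0 => n; rewrite ger0_norm ?normc_ge0// -dotBl.
    rewrite (le_trans (dot_le_nrm hdot _ _))//.
    suff -> : nrm (e k) = 1 by rewrite mulr1.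
    apply/eqP; rewrite -(@eqrXn2 _ 2) ?nrm_ge0// expr1n.
    by rewrite -(inj_eq (@complexI R)) -(dotxx hdot) e_on eqxx.
  apply: (@ccvg_ext _ (fun=> a k) _ _ k.+1); last exact: ccvg_cst.
  by move=> n kn; rewrite dot_sum_e leq0n kn.
apply/ler_addgt0Pr => eps /((cvg0P _).1 xlim)[N /(_ N (leqnn _))].
rewrite ger0_norm ?nrm_ge0// => h.
set s := \sum_(_ <= _ < _) _ in h.
have -> : x = s - (s - x) by rewrite opprB addrC subrK.
rewrite (le_trans (nrmB _ _))// lerD//.
by rewrite -(@ler_pXn2r _ 2) ?nnegrE ?nrm_ge0// nrm_sum_e.
Qed.

(** The vector that [riesz_fischer] builds from the coordinates of [x] is [x] itself by
    completeness, so the partial sums converge to [x]. *)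
Lemma parseval x y :
  ccvg (fun n => \sum_(0 <= k < n) dot x (e k) * Num.conj (dot y (e k))) (dot x y).
Proof.
have [x' [x'E _ x'lim]] := riesz_fischer (bessel x) (nrm_ge0 x).
have {x'E} x'E : x' = x by exact: coord_inj.
have := cvg0Mr (nrm y) x'lim; rewrite x'E.
apply: squeeze0 => n /=; rewrite ger0_norm ?normc_ge0//.
apply: le_trans (dot_le_nrm hdot _ _); rewrite dotBl dot_suml.
rewrite (eq_bigr (fun k => dot (dot x (e k) *: e k) y))// => k _.
by rewrite dotZl [dot (e k) y]dotC.
Qed.

End OrthonormalBasis.

(** * Dominated convergence of series; convergence and non-vanishing of infinite products *)

Section InfiniteProducts.
Variable R : realType.

(** Beyond a fixed index the sums are small uniformly in N by domination; the finitely many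
    remaining terms tend to 0. Both the terms and the truncation depend on N. *)
Lemma tannery (u : nat -> nat -> R) (b : nat -> R) (B : R) :
  (forall N k, 0 <= u N k <= b k) ->
  (forall n, \sum_(0 <= k < n) b k <= B) ->
  (forall k, u^~ k @ \oo --> (0 : R)) ->
  (fun N => \sum_(0 <= k < N) u N k) @ \oo --> (0 : R).
Proof.
move=> ub bB u0; apply/cvg0P => eps eps0.
have b_ge0 k : 0 <= b k.
  by have /andP[h1 h2] := ub 0%N k; exact: le_trans h2.
have u_ge0 N k : 0 <= u N k by have /andP[] := ub N k.
have Smono m n : (m <= n)%N -> \sum_(0 <= i < m) b i <= \sum_(0 <= i < n) b i.
  by move=> mn; rewrite [leRHS](big_cat_nat (leq0n _) mn)//= lerDl sumr_ge0.
have [M hM] := bounded_mono_cauchy Smono bB (divr_gt0 eps0 (ltr0Sn R 1)).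
have : (fun N => \sum_(0 <= k < M) u N k) @ \oo --> (0 : R).
  elim: (M) => [|m ih].
    by apply/cvg0P => e e0; exists 0%N => n _; rewrite big_nil normr0 ltW.
  have := cvg0D ih (u0 m); apply: squeeze0 => n.
  by rewrite big_nat_recr//= ger0_norm// addr_ge0 ?sumr_ge0.
move=> /cvg0P/(_ _ (divr_gt0 eps0 (ltr0Sn R 1)))[N1 hN1].
exists (maxn M N1) => N; rewrite geq_max => /andP[MN NN].
rewrite ger0_norm ?sumr_ge0// (big_cat_nat (leq0n _) MN)//=.
have := hN1 N NN; rewrite ger0_norm ?sumr_ge0// => h1.
have h2 : \sum_(M <= k < N) u N k <= \sum_(M <= k < N) b k.
  by apply: ler_sum => k _; have /andP[] := ub N k.
have := hM M N; rewrite leqnn => /(_ MN).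
rewrite [X in X - _](big_cat_nat (leq0n _) MN)//= addrAC subrr add0r.
by lra.
Qed.

Variables (f : nat -> R[i]) (a : nat -> R) (B : R).
Hypothesis fa : forall k, normc (f k - 1) <= a k.
Hypothesis aB : forall n, \sum_(0 <= k < n) a k <= B.

Lemma prod_factor_ge0 k : 0 <= a k.
Proof. exact: le_trans (normc_ge0 _) (fa k). Qed.

Lemma normc_prod_le n : normc (\prod_(0 <= k < n) f k) <= expR B.
Proof.
apply: le_trans (_ : expR (\sum_(0 <= k < n) a k) <= _); last by rewrite ler_expR.
elim: n => [|n ih]; first by rewrite !big_nil expR0 normc1.
rewrite !big_nat_recr//= normcM expRD ler_pM ?normc_ge0//.
apply: le_trans (expR_ge1Dx _).
rewrite (_ : f n = 1 + (f n - 1)); last by ring.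
by rewrite (le_trans (normcD _ _))// normc1 lerD2l.
Qed.

Lemma prod_cvg : exists p, ccvg (fun n => \prod_(0 <= k < n) f k) p.
Proof.
apply: (@ccvg_of_increments _ _ (fun n => expR B * a n) (expR B * B)) => n.
  rewrite big_nat_recr//= (_ : _ * _ - _ = (\prod_(0 <= k < n) f k) * (f n - 1)).
    by rewrite normcM ler_pM ?normc_ge0// normc_prod_le.
  by ring.
by rewrite -mulr_sumr ler_wpM2l ?expR_ge0.
Qed.

(** Once the tail of the sum of [a] is at most 1/2, the inequality prod |f_k| >= 1 - sum a_k keeps
    the tail product above 1/2; the head is a finite product of nonzero factors. *)
Lemma prod_cvg_neq0 p : (forall k, f k != 0) ->
  ccvg (fun n => \prod_(0 <= k < n) f k) p -> p != 0.
Proof.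
move=> f0 fp.
have Smono m n : (m <= n)%N -> \sum_(0 <= i < m) a i <= \sum_(0 <= i < n) a i.
  by move=> mn; rewrite [leRHS](big_cat_nat (leq0n _) mn)//= lerDl sumr_ge0// => i _;
     exact: prod_factor_ge0.
have [M hM] := bounded_mono_cauchy Smono aB (divr_gt0 ltr01 (ltr0Sn R 1)).
have tail n : (M <= n)%N -> \sum_(M <= k < n) a k <= 1 / 2.
  move=> Mn; have := hM M n; rewrite leqnn => /(_ Mn).
  by rewrite [X in X - _](big_cat_nat (leq0n _) Mn)//= addrAC subrr add0r.
have low n : 1 - \sum_(M <= k < M + n) a k <= normc (\prod_(M <= k < M + n) f k).
  elim: n => [|n ih]; first by rewrite addn0 !big_geq// normc1 subr0.
  rewrite addnS !big_nat_recr ?leq_addr//= normcM.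
  have h1 := tail _ (leq_addr n M).
  have h2 := tail _ (leq_addr n.+1 M).
  rewrite addnS big_nat_recr ?leq_addr//= in h2.
  have h3 := prod_factor_ge0 (M + n).
  have h4 : 0 <= \sum_(M <= k < M + n) a k.
    by rewrite sumr_ge0// => i _; exact: prod_factor_ge0.
  have h5 : 1 - a (M + n)%N <= normc (f (M + n)%N).
    have := normcB 1 (1 - f (M + n)%N); rewrite subKr => h.
    have := normcB (f (M + n)%N) (f (M + n)%N - 1).
    rewrite subKr normc1; have := fa (M + n)%N; lra.
  set s := \sum_(_ <= _ < _) _ in ih h1 h2 h4 *.
  have h6 : (1 - s) * (1 - a (M + n)%N) <=
     normc (\prod_(M <= k < M + n) f k) * normc (f (M + n)%N).
    by apply: ler_pM => //; lra.
  have : 0 <= s * a (M + n)%N by rewrite mulr_ge0.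
  by lra.
have pM : 0 < normc (\prod_(0 <= k < M) f k).
  by rewrite normc_gt0 prodf_seq_neq0; apply/allP => k _; rewrite f0.
rewrite -normc_gt0; apply: lt_le_trans (_ : normc (\prod_(0 <= k < M) f k) / 2 <= _).
  by rewrite divr_gt0.
apply: (@ccvg_normc_ge _ _ _ _ M) fp => n Mn.
rewrite [in leRHS](big_cat_nat (leq0n _) Mn)//= normcM ler_pM2l//.
have := low (n - M)%N; rewrite subnKC//; have := tail n Mn.
by lra.
Qed.

End InfiniteProducts.

(** * Lagrange interpolation *)

Section PartialFractions.
Variable F : fieldType.

Lemma lagrange_interp (I : eqType) (r : seq I) (x : I -> F) (P : {poly F}) z :
  uniq (map x r) -> (size P <= size r)%N ->
  P.[z] = \sum_(n <- r) P.[x n] / \prod_(k <- r | k != n) (x n - x k)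
            * \prod_(k <- r | k != n) (z - x k).
Proof.
move=> ur sP.
have r_uniq : uniq r by apply: map_uniq ur.
have x_inj k n : k \in r -> n \in r -> x k = x n -> k = n.
  move=> kr nr e; apply: contraTeq ur => kn.
  apply/negP => ur; have := uniqP (x k) ur.
  rewrite size_map => /(_ (index k r) (index n r)).
  rewrite !inE !index_mem => /(_ kr nr).
  rewrite !(nth_map k) ?index_mem// !nth_index// => /(_ e) h.
  by move/eqP: kn; apply; rewrite -(nth_index k kr) h nth_index.
pose c n := P.[x n] / \prod_(k <- r | k != n) (x n - x k).
pose Q := P - \sum_(n <- r) c n *: \prod_(k <- r | k != n) ('X - (x k)%:P).
have QE y : Q.[y] = P.[y] - \sum_(n <- r) c n * \prod_(k <- r | k != n) (y - x k).
  rewrite /Q hornerD hornerN horner_sum; congr (_ - _); apply: eq_bigr => n _.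
  rewrite hornerZ horner_prod; congr (_ * _); apply: eq_bigr => k _.
  by rewrite hornerXsubC.
suff Q0 : Q = 0 by apply/eqP; rewrite -subr_eq0 -QE Q0 horner0.
apply: (@roots_geq_poly_eq0 _ _ (map x r)) => //; last first.
  rewrite size_map; apply: leq_trans (size_polyD _ _) _.
  rewrite geq_max sP size_polyN /=.
  apply: leq_trans (size_sum _ _ _) _; apply/bigmax_leqP_seq => n nr _.
  apply: leq_trans (size_scale_leq _ _) _.
  rewrite -big_filter size_prod_XsubC size_filter.
  rewrite -(count_predC (pred1 n)) -[X in (X < _)%N]add0n -ltnS ltnS.
  rewrite -addSn leq_add// ?(count_uniq_mem _ r_uniq) ?nr//.
apply/allP => _ /mapP[m mr ->]; rewrite rootE QE.
rewrite [\sum_(n <- r) _](bigD1_seq m)//= [\sum_(i <- r | _) _]big1 ?addr0; last first.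
  move=> n nm; rewrite (big_rem m)//= eq_sym nm subrr mul0r mulr0 //.
rewrite /c divfK ?subrr// prodf_seq_neq0; apply/allP => k kr.
apply/implyP => km; rewrite subr_eq0; apply: contra km => /eqP e.
by apply/eqP/x_inj.
Qed.

End PartialFractions.

(** * Residues of the characteristic product and its expansion at a point *)

Section Residues.
Variables (R : realType) (l : nat -> R) (d : R).
Hypothesis d0 : 0 < d.
Hypothesis l_sep : forall j k, j != k -> d <= `|l j - l k|.
Variables (nu : nat -> R[i]) (B : R).
Local Notation L k := ((l k)%:C : R[i]).
Local Notation b k := (normc (nu k - L k)).
Hypothesis bB : forall n, \sum_(0 <= k < n) b k <= B.
Implicit Types (mu : R[i]) (K D : seq nat).

Lemma L_neq j k : j != k -> L j - L k != 0.
Proof.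
move=> jk; rewrite -normc_gt0 -real_complexB normc_real.
exact: lt_le_trans d0 (l_sep jk).
Qed.

Lemma L_inj : injective (fun k => L k).
Proof.
by move=> j k e; apply/eqP; apply: contraT => /L_neq; rewrite e subrr eqxx.
Qed.

Definition residue_factor n k : R[i] :=
  if k == n then 1 else (nu k - L n) / (L k - L n).

(** For n < N this is minus the residue at [L n] of prod_(k < N) (z - nu_k)/(z - L_k); the sign fits
    <(A - z)^-1 psi, phi>, a sum of c_k/(L_k - z). The factor k = n is set to 1 and its numerator
    stands in front. *)
Definition partial_residue N n : R[i] :=
  (nu n - L n) * \prod_(0 <= k < N) residue_factor n k.

Lemma residue_factor_close n k : normc (residue_factor n k - 1) <= b k / d.
Proof.
rewrite /residue_factor; case: eqVneq => [_|kn].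
  by rewrite subrr normc0 divr_ge0 ?normc_ge0// ltW.
have h := L_neq kn.
rewrite (_ : _ - 1 = (nu k - L k) / (L k - L n)); last by field.
rewrite normcM normcV ler_wpM2l ?normc_ge0// -real_complexB normc_real.
by rewrite lef_pV2 ?posrE ?l_sep// (lt_le_trans d0 (l_sep kn)).
Qed.

Lemma residue_factor_sum n : \sum_(0 <= k < n) b k / d <= B / d.
Proof. by rewrite -mulr_suml ler_pM2r ?invr_gt0. Qed.

(** The bound is uniform in N and summable in n: it passes to the limits [c n] and is the majorant
    for [tannery]. *)
Lemma partial_residue_le N n : normc (partial_residue N n) <= expR (B / d) * b n.
Proof.
rewrite normcM mulrC ler_wpM2r ?normc_ge0//.
exact: (normc_prod_le (residue_factor_close n) residue_factor_sum).
Qed.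

Lemma residue_exists : exists c : nat -> R[i],
  forall n, ccvg (partial_residue^~ n) (c n).
Proof.
suff /choice[c hc] : forall n, exists z, ccvg (partial_residue^~ n) z by exists c.
move=> n; have [p hp] := prod_cvg (residue_factor_close n) residue_factor_sum.
by exists ((nu n - L n) * p); apply: ccvgMl.
Qed.

Variable c : nat -> R[i].
Hypothesis c_lim : forall n, ccvg (partial_residue^~ n) (c n).

Lemma residue_le n : normc (c n) <= expR (B / d) * b n.
Proof.
exact: (@ccvg_normc_le _ _ _ _ 0 (fun N _ => partial_residue_le N n) (c_lim n)).
Qed.

Lemma residue_eq0 n k : nu k = L n -> c n = 0.
Proof.
move=> kn; apply: ccvg_unique (c_lim n) _.
apply: (@ccvg_ext _ (fun=> 0) _ _ k.+1); last exact: ccvg_cst.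
move=> N kN; rewrite /partial_residue.
have [e|nk] := eqVneq k n; first by rewrite -e kn e subrr mul0r.
rewrite (bigD1_seq k) ?mem_index_iota ?iota_uniq//=.
by rewrite /residue_factor (negPf nk) kn subrr !mul0r mulr0.
Qed.

Lemma residue_neq0 n : (forall k, nu k != L n) -> c n != 0.
Proof.
move=> hn; have [p hp] := prod_cvg (residue_factor_close n) residue_factor_sum.
have -> : c n = (nu n - L n) * p.
  by apply: ccvg_unique (c_lim n) _; apply: ccvgMl.
rewrite mulf_neq0 ?subr_eq0//.
apply: (prod_cvg_neq0 (residue_factor_close n) residue_factor_sum) hp => k.
rewrite /residue_factor; case: (eqVneq k n) => [_|kn]; first by rewrite oner_eq0.
by rewrite mulf_neq0 ?invr_eq0 ?L_neq// subr_eq0.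
Qed.

Lemma prod_iota_split (K : seq nat) N (P : pred nat) (F : nat -> R[i]) :
  uniq K -> (forall k, k \in K -> (k < N)%N) ->
  \prod_(0 <= k < N | P k) F k =
  \prod_(0 <= k < N | (k \notin K) && P k) F k * \prod_(k <- K | P k) F k.
Proof.
move=> uK KN; rewrite (bigID (fun k => k \in K))/= mulrC; congr (_ * _).
  by apply: eq_bigl => k; rewrite andbC.
rewrite (eq_bigl (fun k => (k \in K) && P k)); last by move=> k; rewrite andbC.
rewrite -big_filter_cond; apply: perm_big; apply: uniq_perm => //.
  by rewrite filter_uniq// iota_uniq.
move=> k; rewrite mem_filter mem_index_iota leq0n /=.
by case: (boolP (k \in K)) => //= /KN ->.
Qed.

Lemma size_iota_split (K : seq nat) N :
  uniq K -> (forall k, k \in K -> (k < N)%N) ->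
  (size [seq k <- index_iota 0 N | k \notin K] + size K)%N = N.
Proof.
move=> uK KN; rewrite -[RHS](size_iota 0) -{2}[N]subn0 -/(index_iota 0 N).
rewrite -(count_predC (fun k => k \notin K) (index_iota 0 N)) size_filter; congr (_ + _)%N.
rewrite -size_filter; apply/perm_size/uniq_perm => //.
  by rewrite filter_uniq// iota_uniq.
move=> k; rewrite mem_filter mem_index_iota leq0n /= negbK.
by case: (boolP (k \in K)) => //= /KN ->.
Qed.

Lemma prod_const_seq (T : Type) (s : seq T) (x : R[i]) :
  \prod_(k <- s) x = x ^+ size s.
Proof. by elim: s => [|y s ih]; rewrite ?big_nil ?expr0// big_cons ih exprS. Qed.

Lemma size_monic_sub (F : fieldType) (m : nat) (P Q : {poly F}) : P \is monic -> Q \is monic ->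
  size P = m.+1 -> size Q = m.+1 -> (size (P - Q)%R <= m)%N.
Proof.
move=> /monicP Pm /monicP Qm sP sQ; apply/leq_sizeP => j mj; rewrite coefB.
move: mj; rewrite leq_eqVlt => /orP[/eqP <-|mj].
  by move: Pm Qm; rewrite /lead_coef sP sQ /= => -> ->; rewrite subrr.
by rewrite !nth_default ?sP ?sQ// subrr.
Qed.

Variable mu : R[i].
Variables (D K : seq nat).
Hypothesis D_uniq : uniq D.
Hypothesis D_spec : forall k, (k \in D) = (L k == mu).
Hypothesis K_uniq : uniq K.
Hypothesis K_spec : forall k, k \in K -> nu k = mu.
Hypothesis DK : (size D <= size K)%N.

(** The factor (z - nu_k)/(z - L_k) at z = mu, with zeros at [mu] cancelled on [K] and poles at [mu]
    cancelled on [D]. *)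
Definition char_factor k : R[i] :=
  (if k \in K then 1 else mu - nu k) / (if k \in D then 1 else mu - L k).

(** Partial fractions with simple poles at the L_k, k outside [D]. Writing the coefficients through
    the full residues costs a factor (L_k - mu) for each cancelled zero and gains one for each
    cancelled pole, which explains the exponent. *)
Lemma partial_char_expansion N :
  (forall k, k \in D ++ K -> (k < N)%N) ->
  \prod_(0 <= k < N) char_factor k = (size K == size D)%:R +
    \sum_(0 <= k < N | k \notin D)
       partial_residue N k / (L k - mu) ^+ (size K - size D).+1.
Proof.
move=> DKN.
have DN k : k \in D -> (k < N)%N by move=> kD; apply: DKN; rewrite mem_cat kD.
have KN k : k \in K -> (k < N)%N by move=> kK; apply: DKN; rewrite mem_cat kK orbT.
pose r := [seq k <- index_iota 0 N | k \notin D].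
pose r' := [seq k <- index_iota 0 N | k \notin K].
have sr := size_iota_split D_uniq DN; rewrite -/r in sr.
have sr' := size_iota_split K_uniq KN; rewrite -/r' in sr'.
(* Interpolation needs a degree below the number of nodes: automatic if [K] is longer than [D]; for
   equal sizes both products are monic of the same degree and subtraction removes the leading
   term. *)
pose P := \prod_(k <- r') ('X - (nu k)%:P) -
          (size K == size D)%:R *: \prod_(k <- r) ('X - (L k)%:P).
have sP : (size P <= size r)%N.
  rewrite /P; case: eqVneq => [e|ne].
    have er : size r' = size r.
      by apply/eqP; rewrite -(eqn_add2r (size D)) sr -e sr'.
    rewrite scale1r; apply: size_monic_sub; rewrite ?monic_prod_XsubC//.
      by rewrite size_prod_XsubC er.
    by rewrite size_prod_XsubC.
  rewrite scale0r subr0 size_prod_XsubC.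
  have DK' : (size D < size K)%N by rewrite ltn_neqAle eq_sym ne.
  by rewrite -(ltn_add2r (size D)) sr -sr' ltn_add2l.
have r_uniq : uniq r by rewrite filter_uniq// iota_uniq.
have := lagrange_interp (x := fun k => L k) mu _ sP.
rewrite (map_inj_uniq L_inj) => /(_ r_uniq).
have PE z : P.[z] = \prod_(k <- r') (z - nu k) -
    (size K == size D)%:R * \prod_(k <- r) (z - L k).
  rewrite /P hornerD hornerN hornerZ !horner_prod.
  congr (_ - _ * _); apply: eq_bigr => k _; exact: hornerXsubC.
have muL k : k \notin D -> mu - L k != 0.
  by rewrite D_spec subr_eq0 eq_sym.
have r0 : \prod_(k <- r) (mu - L k) != 0.
  rewrite prodf_seq_neq0; apply/allP => k; rewrite mem_filter => /andP[kD _].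
  exact: muL.
rewrite PE => E.
have -> : \prod_(0 <= k < N) char_factor k =
    \prod_(k <- r') (mu - nu k) / \prod_(k <- r) (mu - L k).
  rewrite /r /r' !big_filter prodf_div; congr (_ / _).
    by rewrite [RHS]big_mkcond; apply: eq_bigr => k _; rewrite if_neg.
  by rewrite [RHS]big_mkcond; apply: eq_bigr => k _; rewrite if_neg.
move/(canRL (subrK _)): E => ->; rewrite mulrDl mulfK// addrC; congr (_ + _).
rewrite mulr_suml -[in RHS]big_filter -/r.
apply: eq_big_seq => n; rewrite mem_filter mem_index_iota => /andP[nD nN].
rewrite PE.
have nr : n \in r by rewrite mem_filter nD mem_index_iota.
have -> : \prod_(k <- r) (L n - L k) = 0.
  by rewrite (big_rem n)//= subrr mul0r.
rewrite mulr0 subr0 [\prod_(k <- r) _](bigD1_seq n)//=.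
have Lmu : L n - mu != 0 by rewrite -opprB oppr_eq0 muL.
set pr := \prod_(k <- r') _.
set q := \prod_(k <- r | k != n) (L n - L k).
set s := \prod_(k <- r | k != n) (mu - L k).
have s0 : s != 0.
  rewrite prodf_seq_neq0; apply/allP => k; rewrite mem_filter => /andP[kD _].
  by rewrite muL// implybT.
have q0 : q != 0.
  rewrite prodf_seq_neq0; apply/allP => k _; apply/implyP => kn.
  by rewrite L_neq// eq_sym.
(* Every cancelled numerator, evaluated at [L n], equals L n - mu. *)
have num : \prod_(0 <= k < N) (L n - nu k) = pr * (L n - mu) ^+ size K.
  rewrite (prod_iota_split _ _ K_uniq KN) /pr /r' big_filter.
  congr (_ * _); first by apply: eq_bigl => k; rewrite andbT.
  rewrite -prod_const_seq; apply: eq_big_seq => k kK; by rewrite K_spec.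
have den : \prod_(0 <= k < N | k != n) (L n - L k) = q * (L n - mu) ^+ size D.
  rewrite (prod_iota_split _ _ D_uniq DN) /q /r big_filter_cond.
  congr (_ * _); rewrite -prod_const_seq big_seq_cond [RHS]big_seq_cond.
  apply: eq_big => k; last by rewrite D_spec => /andP[/eqP -> _].
  by case: (boolP (k \in D)) => //= kD; apply: contraNneq nD => <-.
have -> : partial_residue N n =
    - (\prod_(0 <= k < N) (L n - nu k) / \prod_(0 <= k < N | k != n) (L n - L k)).
  rewrite /partial_residue [in RHS](bigD1_seq n) ?mem_index_iota ?iota_uniq//=.
  rewrite (bigD1_seq n) ?mem_index_iota ?iota_uniq//= {1}/residue_factor eqxx mul1r.
  rewrite -mulrA -prodf_div -mulNr opprB; congr (_ * _); apply: eq_bigr => k kn.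
  rewrite /residue_factor (negPf kn) -(opprB (nu k)) -(opprB (L k)) invrN mulrNN.
  by [].
rewrite num den -{1}(subnK DK) exprD exprS.
have mL := muL _ nD.
rewrite -[mu - L n]opprB.
by field; rewrite ?expf_neq0 ?q0 ?s0 ?Lmu.
Qed.

(** [q] is the infinite product of the [char_factor]s, nonzero exactly when [K] has cancelled every
    zero at [mu]. *)
Lemma char_limit : exists q,
  [/\ ccvg (fun N => (size K == size D)%:R +
        \sum_(0 <= k < N | k \notin D) c k / (L k - mu) ^+ (size K - size D).+1) q,
      (forall k, nu k = mu -> k \in K) -> q != 0 &
      (exists2 k, nu k = mu & k \notin K) -> q = 0].
Proof.
have [s s0 hs] := punctured_gap d0 l_sep mu.
pose M := (\max_(k <- D ++ K) k).+1.
have DKM k : k \in D ++ K -> (k < M)%N by move=> kDK; rewrite ltnS leq_bigmax_seq.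
pose x k := normc (char_factor k - 1).
(* The estimate b k / s fails where a factor has been altered; that happens only below [M], and
   adding [x k] there keeps the majorant summable. *)
pose a k := b k / s + (if (k < M)%N then x k else 0).
have x_ge0 k : 0 <= x k by exact: normc_ge0.
have ffa k : normc (char_factor k - 1) <= a k.
  rewrite /a; case: ltnP => kM; first by rewrite lerDr divr_ge0 ?normc_ge0// ltW.
  rewrite addr0.
  have : k \notin D ++ K by apply: contraL kM => /DKM; rewrite -ltnNge.
  rewrite mem_cat negb_or => /andP[kD kK].
  rewrite /char_factor (negPf kD) (negPf kK).
  have Lmu : L k != mu by rewrite -D_spec.
  have muL : mu - L k != 0 by rewrite subr_eq0 eq_sym.
  rewrite (_ : _ - 1 = (L k - nu k) / (mu - L k)); last by field.
  rewrite normcM normcV normc_distC [normc (mu - _)]normc_distC.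
  rewrite ler_wpM2l ?normc_ge0// lef_pV2 ?posrE ?hs//.
  by rewrite (lt_le_trans s0)// hs.
have aB n : \sum_(0 <= k < n) a k <= B / s + \sum_(0 <= k < M) x k.
  rewrite big_split /= lerD//; first by rewrite -mulr_suml ler_pM2r ?invr_gt0.
  rewrite -big_mkcond /= (big_nat_widen _ _ _ _ _ (leq_maxr n M)) /=.
  rewrite [leRHS](big_cat_nat (leq0n _) (leq_maxl n M))/= lerDl.
  by rewrite sumr_ge0.
have [q hq] := prod_cvg ffa aB.
exists q; split.
- pose j := (size K - size D).+1.
  have E0 : 0 <= expR (B / d) by exact: expR_ge0.
  have W0 : 0 <= s^-1 ^+ j by rewrite exprn_ge0// invr_ge0 ltW.
  (* Replaces the residues of the truncated products by their limits inside the sum, by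
     [tannery]. *)
  pose u N k := (normc (c k - partial_residue N k)) * s^-1 ^+ j.
  have u0 : (fun N => \sum_(0 <= k < N) u N k) @ \oo --> (0 : R).
    apply: (@tannery _ _ (fun k => (expR (B / d) * b k * 2) * s^-1 ^+ j)
      (expR (B / d) * B * 2 * s^-1 ^+ j)).
    + move=> N k; rewrite mulr_ge0 ?normc_ge0//= ler_wpM2r//.
      rewrite (le_trans (normcB _ _))//.
      have := residue_le k; have := partial_residue_le N k; lra.
    + move=> n; rewrite -!mulr_suml ler_wpM2r// ler_wpM2r// -mulr_sumr.
      by rewrite ler_wpM2l.
    + move=> k; rewrite /u; apply: cvg0Mr.
      by have := c_lim k; apply: squeeze0 => N; rewrite ger0_norm ?normc_ge0// normc_distC.
  have v0 : ccvg (fun N => \sum_(0 <= k < N | k \notin D)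
      (c k - partial_residue N k) / (L k - mu) ^+ j) 0.
    apply: squeeze0 u0 => N; rewrite ger0_norm ?normc_ge0// subr0.
    rewrite (le_trans (normc_sum _ _ _))// big_mkcond /=; apply: ler_sum => k _.
    case: ifPn => kD; last by rewrite /u mulr_ge0 ?normc_ge0.
    rewrite normcM normcV normcX /u ler_wpM2l ?normc_ge0// exprVn.
    have Lmu : L k != mu by rewrite -D_spec.
    have sk := hs k Lmu.
    have k0 : 0 < normc (L k - mu) by exact: lt_le_trans sk.
    by rewrite lef_pV2 ?posrE ?exprn_gt0// ler_pXn2r// nnegrE ltW.
  have := ccvgD hq v0; rewrite addr0; apply: (@ccvg_ext _ _ _ _ M) => N MN.
  rewrite partial_char_expansion; last first.
    by move=> k /DKM kM; exact: leq_trans MN.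
  rewrite -addrA -big_split /=; congr (_ + _); apply: eq_bigr => k _.
  by rewrite -mulrDl addrC subrK.
- move=> hK; apply: (prod_cvg_neq0 ffa aB) hq => k; rewrite /char_factor.
  rewrite mulf_neq0 ?invr_eq0//.
    case: ifPn => kK; first by rewrite oner_eq0.
    by rewrite subr_eq0; apply: contraNneq kK => e; apply: hK.
  case: ifPn => kD; first by rewrite oner_eq0.
  by rewrite subr_eq0 eq_sym -D_spec.
- move=> [k kmu kK]; apply: ccvg_unique hq _.
  apply: (@ccvg_ext _ (fun=> 0) _ _ k.+1); last exact: ccvg_cst.
  move=> N kN; rewrite (bigD1_seq k) ?mem_index_iota ?iota_uniq//=.
  by rewrite /char_factor (negPf kK) kmu subrr !mul0r.
Qed.

End Residues.

(** * Root subspace spanned by a maximal Jordan chain *)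

Section JordanChain.
Variables (R : realType) (H : completeNormedModType R[i]).
Variables (T : operator H) (mu : R[i]).
Hypothesis T_lin : linear_op T.
Local Notation S := (op_shift T mu).

Lemma linear_op_sum n (c : nat -> R[i]) (y : nat -> H) :
  (forall i, (i < n)%N -> dom T (y i)) ->
  dom T (\sum_(i < n) c i *: y i) /\
  T (\sum_(i < n) c i *: y i) = \sum_(i < n) c i *: T (y i).
Proof.
have T0 : T 0 = 0.
  have [_] := T_lin.2 1 0 0 T_lin.1 T_lin.1.
  rewrite !scale1r addr0 => /eqP; rewrite -subr_eq0 opprD addNKr oppr_eq0.
  by move=> /eqP.
elim: n => [|n ih] hy; first by rewrite !big_ord0; split=> //; exact: T_lin.1.
have [d1 e1] : dom T (\sum_(i < n) c i *: y i) /\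
  T (\sum_(i < n) c i *: y i) = \sum_(i < n) c i *: T (y i).
  by apply: ih => i ilt; apply: hy; exact: ltnW.
rewrite !big_ord_recr /= ![_ + c n *: _]addrC -e1.
exact: T_lin.2 (hy _ (ltnSn n)) d1.
Qed.

Lemma op_shift_sum n (c : nat -> R[i]) (y : nat -> H) :
  (forall i, (i < n)%N -> dom T (y i)) ->
  S (\sum_(i < n) c i *: y i) = \sum_(i < n) c i *: S (y i).
Proof.
move=> hy; rewrite /= (linear_op_sum c hy).2 scaler_sumr -sumrB.
by apply: eq_bigr => i _; rewrite scalerBr !scalerA mulrC.
Qed.

(** [op_pow] peels off the outermost factor; inductions along a chain need the innermost one,
    domains included. *)
Lemma op_powS (Q : operator H) k z :
  (dom (op_pow Q k.+1) z <-> dom Q z /\ dom (op_pow Q k) (Q z)) /\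
  op_pow Q k.+1 z = op_pow Q k (Q z).
Proof.
elim: k => [|k [ih1 ih2]]; first by split=> //=; split=> [[]|[]].
split; last first.
  by change (Q (op_pow Q k.+1 z) = Q (op_pow Q k (Q z))); rewrite ih2.
change ((dom (op_pow Q k.+1) z /\ dom Q (op_pow Q k.+1 z)) <->
  (dom Q z /\ (dom (op_pow Q k) (Q z) /\ dom Q (op_pow Q k (Q z))))).
by rewrite ih2; split=> [[/ih1[? ?] ?]//|[? [? ?]]]; split=> //; apply/ih1.
Qed.

Variables (r : nat) (y : nat -> H).
Hypothesis y_dom : forall i, (i <= r)%N -> dom T (y i).
Hypothesis y_eig : S (y 0%N) = 0.
Hypothesis y_chain : forall i, (i < r)%N -> S (y i.+1) = y i.
Hypothesis y0_neq0 : y 0%N != 0.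
Hypothesis y_ker : forall z, dom T z -> S z = 0 -> exists a, z = a *: y 0%N.
Hypothesis y_max : forall z, dom T z -> S z != y r.

Lemma chain_shift_sum n (c : nat -> R[i]) : (n <= r)%N ->
  S (\sum_(i < n.+1) c i *: y i) = \sum_(i < n) c i.+1 *: y i.
Proof.
move=> nr; rewrite op_shift_sum; last by move=> i ilt; apply: y_dom; exact: leq_trans nr.
rewrite big_ord_recl y_eig scaler0 add0r; apply: eq_bigr => i _.
by rewrite lift0 y_chain// (leq_trans (ltn_ord i)).
Qed.

Lemma chain_indep n (c : nat -> R[i]) : (n <= r.+1)%N ->
  \sum_(i < n) c i *: y i = 0 -> forall i, (i < n)%N -> c i = 0.
Proof.
elim: n c => [|n ih] c nr s0 i //.
have tl j : (j < n)%N -> c j.+1 = 0.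
  apply: (ih (fun i => c i.+1)) => //; first exact: ltnW.
  rewrite -chain_shift_sum// s0 /=.
  have := @op_shift_sum 0 c y; rewrite !big_ord0; apply => //.
case: i => [_|i]; last by move=> ilt; exact: tl.
move: s0; rewrite big_ord_recl big1 => [|j _]; last by rewrite lift0 tl// scale0r.
rewrite addr0 => /eqP; rewrite scaler_eq0 (negPf y0_neq0) orbF => /eqP; exact.
Qed.

(** By induction S z is a combination of the chain. Subtracting from [z] the combination shifted up
    by one leaves S (z - u) = c_r y_r; maximality forces c_r = 0, so z - u lies in the kernel, the
    line of y_0. *)
Lemma chain_span k z : dom (op_pow S k) z -> op_pow S k z = 0 ->
  exists c : nat -> R[i], z = \sum_(i < r.+1) c i *: y i.
Proof.
elim: k z => [|k ih] z.
  move=> _ /= ->; exists (fun=> 0); rewrite big1// => i _; exact: scale0r.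
move=> /(op_powS _ _ _).1[dz dSz]; rewrite (op_powS _ _ _).2 => /(ih _ dSz)[c hc].
pose u := \sum_(i < r) c i *: y i.+1.
have hy i : (i < r)%N -> dom T (y i.+1) by move=> ir; exact: y_dom.
have [du _] := linear_op_sum c hy.
have Su : S u = \sum_(i < r) c i *: y i.
  by rewrite (op_shift_sum c hy); apply: eq_bigr => i _; rewrite y_chain.
have [dzu Tzu] := T_lin.2 (-1) u z du dz.
have Szu : S (-1 *: u + z) = c r *: y r.
  have -> : S (-1 *: u + z) = S z - S u.
    rewrite /= Tzu !scaleN1r scalerDr scalerN !opprD !opprK.
    by rewrite addrACA addrC.
  by rewrite hc Su big_ord_recr /= addrAC subrr add0r.
have cr0 : c r = 0.
  apply/eqP; apply: contraT => cr0; exfalso.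
  have [dv Tv] := T_lin.2 (c r)^-1 _ 0 dzu T_lin.1.
  move/eqP: (y_max dv); apply.
  have T0 : T 0 = 0.
    by have := (@linear_op_sum 0 c y); rewrite !big_ord0; case.
  rewrite /= Tv T0 !addr0 scalerA mulrC -scalerA -scalerBr.
  rewrite -[X in _ *: X]/(S (-1 *: u + z)) Szu scalerA mulVf// scale1r //.
move: Szu; rewrite cr0 scale0r => /(y_ker dzu)[a ha].
exists (fun i => if i is j.+1 then c j else a).
rewrite big_ord_recl -ha.
rewrite (eq_bigr (fun i : 'I_r => c i *: y i.+1)); last by move=> i _; rewrite lift0.
by rewrite -/u scaleN1r addrAC addNr add0r.
Qed.

Lemma chain_alg_mult : alg_mult T mu r.+1.
Proof.
exists (fun i : 'I_r.+1 => y i); split.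
  move=> c hc i; pose c' k := c (inord k).
  rewrite -(inord_val i); apply: (@chain_indep r.+1 c') => //.
  by rewrite -[RHS]hc; apply: eq_bigr => j _; rewrite /c' inord_val.
apply/seteqP; split=> z.
  move=> [dz [k [dk zk]]]; have [c ->] := chain_span dk zk.
  by exists (fun i => c i).
move=> [c ->].
pose c' k := c (inord k).
have -> : \sum_(i < r.+1) c i *: y i = \sum_(i < r.+1) c' i *: y i.
  by apply: eq_bigr => j _; rewrite /c' inord_val.
split.
  by have [] := @linear_op_sum r.+1 c' y (fun i h => y_dom h).
(* Each application of S shifts the coefficients down by one, so n applications kill any combination
   of the first n chain vectors. *)
exists r.+1; elim: {-2}r.+1 (leqnn r.+1) c' => [|n ih] nr c'.
  by rewrite big_ord0.
have hd : dom T (\sum_(i < n.+1) c' i *: y i).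
  have hy i : (i < n.+1)%N -> dom T (y i).
    by move=> ilt; apply: y_dom; rewrite -ltnS (leq_trans ilt).
  by have [] := linear_op_sum c' hy.
have [d1 e1] := ih (ltnW nr) (fun i => c' i.+1).
have [p1 p2] := op_powS S n (\sum_(i < n.+1) c' i *: y i).
rewrite p2 chain_shift_sum//; split=> //.
by apply/p1; split=> //; rewrite chain_shift_sum.
Qed.

End JordanChain.

Lemma card_uniq_list (K : seq nat) (P : set nat) : uniq K ->
  (forall k, k \in K <-> P k) -> (P #= `I_(size K))%card.
Proof.
move=> uK KP.
have -> : P = nth 0%N K @` `I_(size K).
  apply/seteqP; split=> k.
    by move=> /KP kK; exists (index k K); rewrite ?nth_index//= index_mem.
  by move=> [i /= iK <-]; apply/KP; rewrite mem_nth.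
apply: inj_card_eq => i j; rewrite !inE /= => iK jK.
by move=> /eqP; rewrite nth_uniq// => /eqP.
Qed.

Lemma mul_div_exprS (F : fieldType) (a b : F) j : a != 0 ->
  a * (b / a ^+ j.+1) = b / a ^+ j.
Proof. by move=> a0; rewrite exprS invfM mulrCA [a * _]mulrA divff// mul1r. Qed.

(** * The rank-one perturbation *)

Section Perturbation.
Variables (R : realType) (H : completeNormedModType R[i])
  (dot : {dot H for (@Num.conj R[i])}).
Hypothesis hdot : hilbert_form dot.
Variable A : operator H.
Hypothesis hA : self_adjoint dot A.
Variables (l : nat -> R) (d : R).
Hypothesis d0 : 0 < d.
Hypothesis l_sep : forall j k, j != k -> d <= `|l j - l k|.
Hypothesis hspec : spectrum A = [set (l k)%:C | k in [set: nat]].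
Local Notation L k := ((l k)%:C : R[i]).
Variable e : nat -> H.
Hypothesis e_dom : forall k, dom A (e k).
Hypothesis e_on : forall j k, dot (e j) (e k) = (j == k)%:R.
Hypothesis e_complete : forall x, (forall k, dot x (e k) = 0) -> x = 0.
Hypothesis A_coord : forall x k, dom A x -> dot (A x) (e k) = L k * dot x (e k).
Variables (nu : nat -> R[i]) (B : R).
Hypothesis bB : forall n, \sum_(0 <= k < n) normc (nu k - L k) <= B.
Variable c : nat -> R[i].
Hypothesis c_lim : forall n, ccvg ((partial_residue l nu)^~ n) (c n).
Implicit Types (x y z : H) (a mu : R[i]).

(* |phi_k|^2 = |c_k| + 2^-k keeps every coordinate of phi nonzero even where
   c_k = 0; this makes the eigenvalues of the perturbation geometrically
   simple. *)
Lemma perturbation_vectors : exists phi psi : H, forall k,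
  dot phi (e k) != 0 /\ dot psi (e k) * Num.conj (dot phi (e k)) = c k.
Proof.
pose g k : R := Num.sqrt (normc (c k) + 2^-1 ^+ k).
have half0 k : 0 < 2^-1 ^+ k :> R by rewrite exprn_gt0// invr_gt0.
have g2 k : g k ^+ 2 = normc (c k) + 2^-1 ^+ k.
  by rewrite sqr_sqrtr// addr_ge0 ?normc_ge0// ltW.
have g0 k : 0 < g k by rewrite sqrtr_gt0 ltr_wpDl ?normc_ge0.
have csum n : \sum_(0 <= k < n) normc (c k) <= expR (B / d) * B.
  apply: le_trans (_ : \sum_(0 <= k < n) expR (B / d) * normc (nu k - L k) <= _).
    by apply: ler_sum => k _; exact: (residue_le d0 l_sep bB c_lim).
  by rewrite -mulr_sumr ler_wpM2l ?expR_ge0.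
have B0 : 0 <= B by have := bB 0; rewrite big_nil.
have half_sum n : \sum_(0 <= k < n) 2^-1 ^+ k = 2 - 2 * 2^-1 ^+ n :> R.
  elim: n => [|n ih]; first by rewrite big_nil expr0; lra.
  by rewrite big_nat_recr//= ih exprS; lra.
pose C := expR (B / d) * B + 2.
have C0 : 0 <= C by rewrite addr_ge0// mulr_ge0// expR_ge0.
have gsum n : \sum_(0 <= k < n) normc (g k)%:C ^+ 2 <= Num.sqrt C ^+ 2.
  rewrite sqr_sqrtr//.
  rewrite (eq_bigr (fun k => normc (c k) + 2^-1 ^+ k)); last first.
    by move=> k _; rewrite normc_real real_normK ?num_real.
  rewrite big_split /= half_sum /C; have := csum n; have := half0 n; lra.
have gC k : (g k)%:C != 0 :> R[i] by rewrite (inj_eq (@complexI R) _ 0) gt_eqF.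
have psum n : \sum_(0 <= k < n) normc (c k / (g k)%:C) ^+ 2 <= Num.sqrt C ^+ 2.
  apply: le_trans (gsum n); apply: ler_sum => k _.
  rewrite ler_pXn2r ?nnegrE ?normc_ge0// normcM normcV normc_real gtr0_norm//.
  by rewrite ler_pdivrMr// -expr2 g2 lerDl ltW.
have [phi [phiE _ _]] := riesz_fischer hdot e_on gsum (sqrtr_ge0 C).
have [psi [psiE _ _]] := riesz_fischer hdot e_on psum (sqrtr_ge0 C).
exists phi, psi => k; rewrite phiE psiE conj_real; split=> //.
by rewrite divfK.
Qed.

(** G is the resolvent at i, always available since the eigenvalues are real, after the coordinate
    multiplier (L_k - i)/(L_k - mu), bounded by 1 + |mu - i|/s. The factor (A - i)^-1 puts the
    values in [dom A]. *)
Lemma reduced_resolvent mu : exists (G : H -> H) (K : R),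
  forall y, [/\ dom A (G y), nrm (G y) <= K * nrm y & forall k,
    dot (G y) (e k) = if L k == mu then 0 else dot y (e k) / (L k - mu)].
Proof.
have [s s0 hs] := punctured_gap d0 l_sep mu.
have Li k : L k != 'i%C.
  by apply/eqP => -[_ /eqP]; rewrite eq_sym oner_eq0.
have [T [M M0 [Tdom TK KT Tb]]] := resolvent_pointP hspec Li.
pose m k : R[i] := if L k == mu then 0 else (L k - 'i%C) / (L k - mu).
pose C := 1 + normc (mu - 'i%C) / s.
have C0 : 0 <= C by rewrite addr_ge0// divr_ge0 ?normc_ge0// ltW.
have mC k : normc (m k) <= C.
  rewrite /m; case: (eqVneq (L k) mu) => [_|kmu]; first by rewrite normc0.
  have kmu' : L k - mu != 0 by rewrite subr_eq0.
  rewrite (_ : _ / _ = 1 + (mu - 'i%C) / (L k - mu)); last by field.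
  rewrite (le_trans (normcD _ _))// normc1 lerD2l normcM normcV.
  rewrite ler_wpM2l ?normc_ge0// lef_pV2 ?posrE ?hs//.
  by rewrite (lt_le_trans s0)// hs.
suff /choice[G hG] : forall y, exists x, [/\ dom A x, nrm x <= M * C * nrm y &
    forall k, dot x (e k) = if L k == mu then 0 else dot y (e k) / (L k - mu)].
  by exists G, (M * C).
move=> y.
have asum n : \sum_(0 <= k < n) normc (m k * dot y (e k)) ^+ 2 <= (C * nrm y) ^+ 2.
  apply: le_trans (_ : \sum_(0 <= k < n) C ^+ 2 * normc (dot y (e k)) ^+ 2 <= _).
    apply: ler_sum => k _; rewrite normcM exprMn ler_wpM2r ?sqr_ge0//.
    by rewrite ler_pXn2r ?nnegrE ?normc_ge0.
  rewrite -mulr_sumr exprMn ler_wpM2l ?sqr_ge0//; exact: bessel.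
have [w [wE wn _]] := riesz_fischer hdot e_on asum (mulr_ge0 C0 (nrm_ge0 y)).
exists (T w); split=> [//||k].
  rewrite (le_trans (Tb _ (Tdom w)))// TK -mulrA ler_wpM2l// ltW//.
have h : (L k - 'i%C) * dot (T w) (e k) = m k * dot y (e k).
  by rewrite -wE -{2}(TK w) dotBl dotZl A_coord// mulrBl.
have Lk : L k - 'i%C != 0 by rewrite subr_eq0.
apply: (mulfI Lk); rewrite h /m; case: eqVneq => [_|kmu]; first by rewrite mul0r mulr0.
by rewrite mulrA mulrAC.
Qed.

Variables phi psi : H.
Hypothesis phi_neq0 : forall k, dot phi (e k) != 0.
Hypothesis psiphi : forall k, dot psi (e k) * Num.conj (dot phi (e k)) = c k.
Local Notation P := (rank_one_perturbation dot A phi psi).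

Lemma conj_phi_neq0 k : Num.conj (dot phi (e k)) != 0.
Proof. by rewrite -normc_eq0 normc_conj normc_eq0. Qed.

Lemma P_linear : linear_op P.
Proof.
split; first exact: (app_linear hA).1.
move=> a x y dx dy; have [d1 e1] := (app_linear hA).2 a x y dx dy.
split=> //=; rewrite e1 dotDl dotZl scalerDl scalerDr scalerA.
by rewrite addrACA.
Qed.

Lemma P_coord mu x k : dom A x -> dot (op_shift P mu x) (e k) =
  (L k - mu) * dot x (e k) + dot x phi * dot psi (e k).
Proof.
move=> dx; rewrite /= dotBl dotDl !dotZl A_coord//; ring.
Qed.

(** * Multiplicity of the perturbation at a point [mu]: [D] indexes the poles there, [K] the
    zeros *)

Section AtPoint.
Variable mu : R[i].
Variables (D K : seq nat).
Hypothesis D_uniq : uniq D.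
Hypothesis D_spec : forall k, (k \in D) = (L k == mu).
Hypothesis D_size : (size D <= 1)%N.
Hypothesis K_uniq : uniq K.
Hypothesis K_spec : forall k, (k \in K) = (nu k == mu).
Variables (G : H -> H) (C : R).
Hypothesis G_spec : forall y, [/\ dom A (G y), nrm (G y) <= C * nrm y &
  forall k, dot (G y) (e k) = if L k == mu then 0 else dot y (e k) / (L k - mu)].

Lemma G_coord y k : dot (G y) (e k) =
  if k \in D then 0 else dot y (e k) / (L k - mu).
Proof. by rewrite D_spec; have [_ _] := G_spec y. Qed.

Lemma iterG_coord j y k : dot (iter j.+1 G y) (e k) =
  if k \in D then 0 else dot y (e k) / (L k - mu) ^+ j.+1.
Proof.
elim: j => [|j ih]; first by rewrite /= G_coord expr1.
rewrite iterS G_coord ih; have [//|kD] := boolP (k \in D).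
by rewrite -mulrA -invfM -exprSr.
Qed.

Lemma iterG_dom j y : dom A (iter j.+1 G y).
Proof. by rewrite iterS; have [] := G_spec (iter j G y). Qed.

(** The Taylor coefficient of order [j] at [mu] of 1 + <(A - z)^-1 psi, phi>, the term of an
    eigenvalue at [mu] being left out. *)
Definition moment j : R[i] := (j == 0)%:R + dot (iter j.+1 G psi) phi.

Lemma moment_cvg j : ccvg (fun N => \sum_(0 <= k < N | k \notin D)
   c k / (L k - mu) ^+ j.+1) (dot (iter j.+1 G psi) phi).
Proof.
apply: (@ccvg_ext _ _ _ _ 0 _ (parseval hdot e_on e_complete _ _)) => N _.
rewrite [RHS]big_mkcond /=; apply: eq_bigr => k _; rewrite iterG_coord.
by case: (k \in D) => /=; rewrite ?mul0r// mulrAC psiphi.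
Qed.

(** Cancelling [size D + j] zeros gives the exponent j + 1 in [char_limit], whose series is that of
    the moment by [parseval]. *)
Lemma momentE (K' : seq nat) j : uniq K' -> (forall k, k \in K' -> nu k = mu) ->
  size K' = (size D + j)%N ->
  ((forall k, nu k = mu -> k \in K') -> moment j != 0) /\
  ((exists2 k, nu k = mu & k \notin K') -> moment j = 0).
Proof.
move=> uK' K'mu sK'; have DK' : (size D <= size K')%N by rewrite sK' leq_addr.
have [q [hq q1 q2]] :=
  char_limit d0 l_sep bB c_lim D_uniq D_spec uK' K'mu DK'.
suff -> : moment j = q by [].
apply: ccvg_unique hq; rewrite sK' addKn /moment.
rewrite -{2}[size D]addn0 eqn_add2l.
by apply: ccvgD; [exact: ccvg_cst | exact: moment_cvg].
Qed.

Lemma moment_eq0 j : (size D + j < size K)%N -> moment j = 0.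
Proof.
move=> hj; have sK' : size (take (size D + j) K) = (size D + j)%N.
  by rewrite size_take hj.
have [||_] := @momentE (take (size D + j) K) j _ _ sK'.
- exact: take_uniq.
- by move=> k /mem_take; rewrite K_spec => /eqP.
apply; exists (nth 0%N K (size D + j)).
  by apply/eqP; rewrite -K_spec mem_nth.
by rewrite in_take ?mem_nth// index_uniq// ltnn.
Qed.

Lemma moment_neq0 j : size K = (size D + j)%N -> moment j != 0.
Proof.
move=> hj; have [||+ _] := @momentE K j _ _ hj => //.
  by move=> k; rewrite K_spec => /eqP.
by apply => k /eqP; rewrite K_spec.
Qed.

Lemma D_eq m : m \in D -> forall k, (k \in D) = (k == m).
Proof.
move: D_size; case: D => [|m' [|]]//= _; rewrite inE => /eqP -> k.
by rewrite inE.
Qed.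

Lemma app_kernel_trivial y : dom A y -> (forall k, (L k - mu) * dot y (e k) = 0) ->
  dot y phi = 0 -> y = 0.
Proof.
move=> dy hy yphi.
have yD k : k \notin D -> dot y (e k) = 0.
  rewrite D_spec -subr_eq0 => kD; have /eqP := hy k.
  by rewrite mulf_eq0 (negPf kD) => /eqP.
apply: e_complete => k; have [kD|/yD//] := boolP (k \in D).
have yE : y = dot y (e k) *: e k.
  apply: (coord_inj e_complete) => j; rewrite dotZl e_on.
  have [<-|kj] := eqVneq k j; first by rewrite mulr1.
  by rewrite mulr0 yD// (D_eq kD) eq_sym.
move: yphi; rewrite {1}yE dotZl [dot (e k) phi]dotC => /eqP.
by rewrite mulf_eq0 (negPf (conj_phi_neq0 k)) orbF => /eqP.
Qed.

(** If [mu] occurs in [nu], the zero cancels the pole and c_k = 0; since phi_k <> 0, it is psi_k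
    that vanishes. *)
Lemma psi_D_eq0 k : (0 < size K)%N -> k \in D -> dot psi (e k) = 0.
Proof.
move=> K0 kD; have : nth 0%N K 0 \in K by rewrite mem_nth.
rewrite K_spec => /eqP hk; have Lk : L k = mu by apply/eqP; rewrite -D_spec.
have := residue_eq0 c_lim (etrans hk (esym Lk)); rewrite -psiphi => /eqP.
by rewrite mulf_eq0 (negPf (conj_phi_neq0 k)) orbF => /eqP.
Qed.

(** Vanishing of moment 0 means <G psi, phi> = -1, the normalization that makes G psi an
    eigenvector. Vanishing of moment i means that G^(i+1) psi is orthogonal to [phi], where the
    perturbation acts as A. *)
Lemma root_chain r : size K = r.+1 -> is_eigenvalue P mu /\ alg_mult P mu r.+1.
Proof.
move=> sK; have K0 : (0 < size K)%N by rewrite sK.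
(* If [mu] is an eigenvalue of [A], moment r is nonzero and the last chain vector violates its
   condition on <., phi>; the multiple [v] of the eigenvector repairs this, and A - mu does not see
   it. *)
have [v [v_phi vD vnD v_dom]] : exists v : H,
    [/\ dot v phi = (if D is [::] then 0 else - moment r),
        (forall k, k \in D -> dot v (e k) != 0),
        (forall k, k \notin D -> dot v (e k) = 0) & dom A v].
  case D_def : D => [|m D'].
    exists 0; split; rewrite ?dot0l//; last exact: (app_linear hA).1.
    by move=> k _; rewrite dot0l.
  have mD : m \in D by rewrite D_def mem_head.
  have D1 : size D = 1%N by apply/eqP; rewrite eqn_leq D_size D_def.
  exists ((- moment r / Num.conj (dot phi (e m))) *: e m); rewrite -D_def; split.
  - by rewrite dotZl [dot (e m) phi]dotC divfK// conj_phi_neq0.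
  - move=> k; rewrite (D_eq mD) => /eqP ->; rewrite dotZl e_on eqxx mulr1.
    by rewrite mulf_neq0 ?invr_eq0 ?conj_phi_neq0// oppr_eq0 moment_neq0// sK D1.
  - by move=> k; rewrite (D_eq mD) => km; rewrite dotZl e_on eq_sym (negPf km) mulr0.
  - exact: (domZ hA).
pose y i := iter i.+1 G psi + (if i == r then v else 0).
have y_dom i : (i <= r)%N -> dom P (y i).
  move=> _; apply: (domD hA); first exact: iterG_dom.
  by case: ifP => // _; exact: (app_linear hA).1.
have y_phi i : (i <= r)%N -> dot (y i) phi = - (i == 0)%:R.
  move=> ir; suff : moment i + dot (if i == r then v else 0) phi = 0.
    by rewrite /moment -addrA -dotDl => /eqP; rewrite addr_eq0 => /eqP ->; rewrite opprK.
  case: eqVneq => [->|ne]; last first.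
    rewrite dot0l addr0 moment_eq0// sK.
    have ltir : (i < r)%N by rewrite ltn_neqAle ne.
    by rewrite (leq_ltn_trans (leq_add D_size (leqnn i))).
  rewrite v_phi; case D_def : D => [|m D']; last by rewrite subrr.
  by rewrite addr0 moment_eq0// sK D_def.
have y_coord i k : k \notin D ->
    dot (y i) (e k) = dot psi (e k) / (L k - mu) ^+ i.+1.
  move=> kD; rewrite /y dotDl iterG_coord (negPf kD).
  by case: ifP => _; rewrite ?dot0l ?vnD// addr0.
have LD k : k \in D -> L k - mu = 0.
  by rewrite D_spec => /eqP ->; rewrite subrr.
have LnD k : k \notin D -> L k - mu != 0 by rewrite D_spec subr_eq0.
have y_eig : op_shift P mu (y 0%N) = 0.
  apply: (coord_inj e_complete) => k; rewrite dot0l P_coord ?y_phi//; last exact: y_dom.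
  have [kD|kD] := boolP (k \in D).
    by rewrite LD// psi_D_eq0// mul0r mulr0 addr0.
  by rewrite y_coord// expr1 mulrCA divff ?LnD// mulr1 mulN1r addrN.
have y_chain i : (i < r)%N -> op_shift P mu (y i.+1) = y i.
  move=> ir; apply: (coord_inj e_complete) => k.
  rewrite P_coord ?y_phi//; last exact: y_dom.
  rewrite oppr0 mul0r addr0.
  have [kD|kD] := boolP (k \in D).
    by rewrite LD// mul0r /y ltn_eqF// addr0 iterG_coord kD.
  by rewrite !y_coord// mul_div_exprS// LnD.
have y0_neq0 : y 0%N != 0.
  apply/eqP => y0; have := y_phi 0%N (leq0n r); rewrite y0 dot0l eqxx => /eqP.
  by rewrite eq_sym oppr_eq0 oner_eq0.
(* Adding a multiple of the eigenvector y_0, for which <y_0, phi> = -1, makes [z] orthogonal to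
   [phi] and reduces questions about P - mu to A - mu. *)
have reduce z : dom A z -> exists z', [/\ dom A z', dot z' phi = 0,
    z' = z + dot z phi *: y 0%N &
    op_shift P mu z' = op_shift P mu z].
  move=> dz; exists (dot z phi *: y 0%N + z).
  have [d1 e1] := P_linear.2 (dot z phi) (y 0%N) z (y_dom _ (leq0n r)) dz.
  split=> //.
  - by rewrite dotDl dotZl y_phi// mulrN1 addNr.
  - by rewrite addrC.
  - apply: (coord_inj e_complete) => k.
    have h0 := P_coord mu k (y_dom _ (leq0n r)); rewrite y_eig dot0l in h0.
    rewrite !P_coord// !dotDl !dotZl.
    transitivity (dot z phi * ((L k - mu) * dot (y 0%N) (e k) +
        dot (y 0%N) phi * dot psi (e k)) +
      ((L k - mu) * dot z (e k) + dot z phi * dot psi (e k))); first by ring.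
    by rewrite -h0 mulr0 add0r.
have y_ker z : dom P z -> op_shift P mu z = 0 -> exists a, z = a *: y 0%N.
  move=> dz Sz; have [z' [dz' z'phi z'E Sz']] := reduce z dz.
  have z'0 : z' = 0.
    apply: app_kernel_trivial => // k; have := P_coord mu k dz'.
    by rewrite Sz' Sz dot0l z'phi mul0r addr0.
  by exists (- dot z phi); rewrite scaleNr; apply/eqP; rewrite -addr_eq0 -z'E z'0.
(* Without an eigenvalue of [A] at [mu], a preimage would be G^(r+2) psi and the nonzero moment r+1
   would vanish. With one, the range of A - mu has no component along [e m], whereas y_r has that of
   [v]. *)
have y_max z : dom P z -> op_shift P mu z != y r.
  move=> dz; apply/eqP => Sz; have [z' [dz' z'phi _ Sz']] := reduce z dz.
  have hz k : (L k - mu) * dot z' (e k) = dot (y r) (e k).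
    by have := P_coord mu k dz'; rewrite Sz' Sz z'phi mul0r addr0 => ->.
  case D_def : D => [|m D'].
    have kD k : k \notin D by rewrite D_def.
    have : moment r.+1 = 0.
      rewrite /moment add0r -z'phi; congr (dot _ _).
      apply: (coord_inj e_complete) => k.
      rewrite iterG_coord (negPf (kD k)); apply: (mulfI (LnD _ (kD k))).
      by rewrite hz y_coord// mul_div_exprS// LnD.
    by apply/eqP; apply: moment_neq0; rewrite D_def.
  have mD : m \in D by rewrite D_def mem_head.
  have := hz m; rewrite LD// mul0r /y eqxx dotDl iterG_coord mD add0r.
  by move/esym/eqP; rewrite (negPf (vD _ mD)).
split; last exact: (chain_alg_mult P_linear y_dom y_eig y_chain y0_neq0 y_ker y_max).
exists (y 0%N); split=> //; first exact: y_dom.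
by move: y_eig => /= /eqP; rewrite subr_eq0 => /eqP.
Qed.

Lemma resolvent_of_not_nu : size K = 0%N -> resolvent_set P mu.
Proof.
move=> sK.
suff [F [M hF]] : exists F : H -> H, exists M : R, forall y,
    [/\ dom A (F y), op_shift P mu (F y) = y &
     forall x, dom A x -> op_shift P mu x = y -> x = F y /\ nrm x <= M * nrm y].
  split; last first.
    exists M => x dx; rewrite !nrmE -rmorphM lecR.
    by have [_ _ /(_ x dx erefl)[]] := hF (op_shift P mu x).
  split=> //.
    move=> x x' /set_mem dx /set_mem dx' e1.
    have [_ _ h] := hF (op_shift P mu x).
    by rewrite (h x dx erefl).1 (h x' dx' (esym e1)).1.
  by move=> y _; have [d1 e1 _] := hF y; exists (F y).
have LD k : k \in D -> L k - mu = 0.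
  by rewrite D_spec => /eqP ->; rewrite subrr.
have LnD k : k \notin D -> L k - mu != 0 by rewrite D_spec subr_eq0.
have Gdom y : dom A (G y) by have [] := G_spec y.
have Gnrm y : nrm (G y) <= C * nrm y by have [] := G_spec y.
case D_def : D => [|m D'].
  have kD k : k \notin D by rewrite D_def.
  have s0 : moment 0%N != 0 by apply: moment_neq0; rewrite sK D_def.
  pose s := moment 0%N.
  have sE : s = 1 + dot (G psi) phi by rewrite /s /moment eqxx.
  (* Sherman-Morrison formula: here G is the full resolvent of [A] at [mu]. *)
  pose F y := G y - (dot (G y) phi / s) *: G psi.
  exists F; exists (C + C * nrm phi / normc s * (C * nrm psi)) => y.
  have Fphi : dot (F y) phi = dot (G y) phi / s.
    rewrite /F dotBl dotZl; have -> : dot (G psi) phi = s - 1 by rewrite sE addrC addKr.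
    by field.
  split.
  - by apply: (domB hA) => //; exact: (domZ hA).
  - apply: (coord_inj e_complete) => k; rewrite P_coord; last first.
      by apply: (domB hA) => //; exact: (domZ hA).
    rewrite Fphi /F dotBl dotZl !G_coord (negPf (kD k)).
    by field; rewrite s0 LnD.
  - move=> x dx Sx.
    have xE : x = G y - dot x phi *: G psi.
      apply: (coord_inj e_complete) => k.
      rewrite dotBl dotZl !G_coord (negPf (kD k)) -Sx P_coord//.
      by field; rewrite LnD.
    have xphi : dot x phi = dot (G y) phi / s.
      have : dot x phi * s = dot (G y) phi.
        by rewrite sE mulrDr mulr1 {1}xE dotBl dotZl subrK.
      by move=> <-; rewrite mulfK.
    have xF : x = F y by rewrite xE xphi.
    split=> //; rewrite xF /F (le_trans (nrmB _ _))// mulrDl lerD// nrmZ.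
    rewrite normcM normcV; set w := (normc s)^-1.
    have w0 : 0 <= w by rewrite invr_ge0 normc_ge0.
    rewrite [leRHS](_ : _ = C * nrm y * nrm phi * w * (C * nrm psi)); last by ring.
    apply: ler_pM; rewrite ?mulr_ge0 ?normc_ge0 ?nrm_ge0//.
    rewrite ler_wpM2r// (le_trans (dot_le_nrm hdot _ _))//.
    by rewrite ler_wpM2r ?nrm_ge0.
have mD : m \in D by rewrite D_def mem_head.
have Lm : L m = mu by apply/eqP; rewrite -D_spec.
have psim : dot psi (e m) != 0.
  have : c m != 0.
    apply: (residue_neq0 d0 l_sep bB c_lim) => k; rewrite Lm -K_spec.
    by case: (K) sK.
  by rewrite -psiphi; apply: contraNneq => ->; rewrite mul0r.
have phim := conj_phi_neq0 m.
(* Coordinate m of the equation reads <x, phi> psi_m = y_m and fixes <x, phi> = [s y]. The remaining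
   freedom, a multiple [t y] of [e m], is fixed by requiring <F y, phi> = [s y]. *)
pose s y := dot y (e m) / dot psi (e m).
pose t y := (s y - dot (G y) phi + s y * dot (G psi) phi) / Num.conj (dot phi (e m)).
pose F y := G y - s y *: G psi + t y *: e m.
have em1 : nrm (e m) = 1.
  apply/eqP; rewrite -(@eqrXn2 _ 2) ?nrm_ge0// expr1n.
  by rewrite -(inj_eq (@complexI R)) -(dotxx hdot) e_on eqxx.
pose u := (normc (dot psi (e m)))^-1.
pose w := (normc (Num.conj (dot phi (e m))))^-1.
have u0 : 0 <= u by rewrite invr_ge0 normc_ge0.
have w0 : 0 <= w by rewrite invr_ge0 normc_ge0.
have sb y : normc (s y) <= u * nrm y.
  rewrite normcM normcV mulrC ler_wpM2l//.
  by rewrite (le_trans (dot_le_nrm hdot _ _))// em1 mulr1.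
pose q := normc (dot (G psi) phi).
have tb y : normc (t y) <= (u + C * nrm phi + u * q) * w * nrm y.
  rewrite normcM normcV -/w [leRHS]mulrAC ler_wpM2r//.
  rewrite (le_trans (normcD _ _))// [leRHS]mulrDl lerD//.
    rewrite (le_trans (normcB _ _))// [leRHS]mulrDl lerD//.
    by rewrite (le_trans (dot_le_nrm hdot _ _))// [leRHS]mulrAC ler_wpM2r ?nrm_ge0.
  by rewrite normcM [leRHS]mulrAC ler_wpM2r ?normc_ge0.
have F_dom y : dom A (F y).
  by apply: (domD hA); [apply: (domB hA) => //; exact: (domZ hA)|exact: (domZ hA)].
have Fphi y : dot (F y) phi = s y.
  rewrite /F dotDl dotBl !dotZl [dot (e m) phi]dotC divfK//; ring.
exists F; exists (C + u * nrm (G psi) + (u + C * nrm phi + u * q) * w) => y.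
have Fnrm : nrm (F y) <= (C + u * nrm (G psi) + (u + C * nrm phi + u * q) * w) * nrm y.
  rewrite (le_trans (nrmD _ _))// 2!mulrDl lerD//.
    rewrite (le_trans (nrmB _ _))// lerD// nrmZ mulrAC ler_wpM2r ?nrm_ge0//.
  by rewrite nrmZ em1 mulr1.
split=> // [|x dx Sx].
  apply: (coord_inj e_complete) => k; rewrite P_coord// Fphi.
  have [kD|kD] := boolP (k \in D).
    rewrite LD// mul0r add0r /s; move: kD; rewrite (D_eq mD) => /eqP ->.
    by rewrite divfK.
  rewrite /F dotDl dotBl !dotZl !G_coord (negPf kD) e_on.
  have -> : (m == k) = false by rewrite eq_sym -(D_eq mD) (negPf kD).
  rewrite mulr0n mulr0 addr0.
  by field; rewrite LnD.
have sx : dot x phi = s y.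
  by rewrite /s -Sx P_coord// LD// mul0r add0r mulfK.
suff xF : x = F y by rewrite xF.
apply/eqP; rewrite -subr_eq0; apply/eqP/app_kernel_trivial.
- exact: (domB hA).
- move=> k; rewrite dotBl mulrBr.
  have := P_coord mu k dx; rewrite Sx sx => yk.
  have [kD|kD] := boolP (k \in D); first by rewrite LD// !mul0r subrr.
  rewrite /F dotDl dotBl !dotZl !G_coord (negPf kD) e_on.
  have -> : (m == k) = false by rewrite eq_sym -(D_eq mD) (negPf kD).
  rewrite mulr0n mulr0 addr0.
  by rewrite yk; field; rewrite LnD.
- by rewrite dotBl Fphi sx subrr.
Qed.

End AtPoint.
End Perturbation.

Lemma esum_bound_iota (R : realType) (T : choiceType) (I : set T) (f : T -> R)
  (h : nat -> T) : (forall x, 0 <= f x) -> injective h -> (forall k, I (h k)) ->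
  (\esum_(x in I) (f x)%:E < +oo)%E ->
  exists B, forall n, \sum_(0 <= k < n) f (h k) <= B.
Proof.
move=> f0 h_inj hI fin.
exists (fine (\esum_(x in I) (f x)%:E)%E) => n.
rewrite -lee_fin fineK; last by rewrite ge0_fin_numE// esum_ge0// => x _; rewrite lee_fin.
apply: esum_ge; exists [set` map h (index_iota 0 n)].
  by split; [exact: finite_seq|move=> x /= /mapP[k _ ->]].
by rewrite -fsbig_seq ?map_inj_uniq ?iota_uniq// big_map sumEFin.
Qed.

(** * The theorem for eigenvalues indexed by the natural numbers *)

Section SequenceIndexed.
Variables (R : realType) (H : completeNormedModType R[i])
  (dot : {dot H for (@Num.conj R[i])}).
Hypothesis hdot : hilbert_form dot.
Variable A : operator H.
Hypothesis hA : self_adjoint dot A.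
Variables (l : nat -> R) (d : R).
Hypothesis d0 : 0 < d.
Hypothesis l_sep : forall j k, j != k -> d <= `|l j - l k|.
Hypothesis hspec : spectrum A = [set (l k)%:C | k in [set: nat]].
Hypothesis hsimple : simple_discrete_spectrum A.
Variables (nu : nat -> R[i]) (B : R).
Hypothesis bB : forall n, \sum_(0 <= k < n) normc (nu k - (l k)%:C) <= B.

Lemma eigenvalue_index mu : exists D : seq nat,
  [/\ uniq D, forall k, (k \in D) = ((l k)%:C == mu) & (size D <= 1)%N].
Proof.
have [[m hm]|h] := pselect (exists m, (l m)%:C = mu).
  exists [:: m]; split=> // k; rewrite inE -hm.
  by rewrite (inj_eq (@L_inj _ _ _ d0 l_sep)).
exists [::]; split=> // k; rewrite in_nil; apply/esym/negbTE/eqP => e.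
by apply: h; exists k.
Qed.

(** If nu_k = mu and l_k differs from [mu], then |nu_k - l_k| >= s, which summability excludes for
    large k. So only an initial segment and [D] contain candidates. *)
Lemma nu_index mu : exists K : seq nat,
  uniq K /\ forall k, (k \in K) = (nu k == mu).
Proof.
have [s s0 hs] := punctured_gap d0 l_sep mu.
have [D [_ D_spec _]] := eigenvalue_index mu.
have Smono m n : (m <= n)%N -> \sum_(0 <= k < m) normc (nu k - (l k)%:C) <=
    \sum_(0 <= k < n) normc (nu k - (l k)%:C).
  move=> mn; rewrite [leRHS](big_cat_nat (leq0n _) mn)//= lerDl sumr_ge0// => i _.
  exact: normc_ge0.
have [M hM] := bounded_mono_cauchy Smono bB (divr_gt0 s0 (ltr0Sn R 1)).
exists [seq k <- undup (iota 0 M ++ D) | nu k == mu]; split.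
  by rewrite filter_uniq// undup_uniq.
move=> k; rewrite mem_filter mem_undup mem_cat mem_iota add0n leq0n /=.
case: eqP => //= kmu; have [//|Mk] := ltnP k M.
rewrite D_spec; apply: contraT => Lk; have := hs k Lk.
have := hM k k.+1; rewrite Mk leqnSn => /(_ isT).
by rewrite big_nat_recr//= addrAC subrr add0r kmu normc_distC; lra.
Qed.

Lemma sequence_rank_one_spectrum : exists phi psi : H,
  let B := rank_one_perturbation dot A phi psi in
  [/\ (forall mu, spectrum B mu -> is_eigenvalue B mu),
      spectrum B = range nu &
      forall mu, is_eigenvalue B mu ->
        exists m : nat, alg_mult B mu m /\ ([set k | nu k = mu] #= `I_m)%card].
Proof.
have [e e_spec] := eigenbasis_exists hA hspec hsimple.
have e_d := e_dom e_spec.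
have e_on := e_orthonormal hdot hA d0 l_sep e_spec.
have e_complete := eigenbasis_complete hdot hA d0 l_sep hspec e_spec.
have A_coord x k := @dot_app_e _ _ _ _ hA _ _ e_spec x k.
have [c c_lim] := residue_exists d0 l_sep bB.
have [phi [psi h]] := perturbation_vectors hdot d0 l_sep e_on bB c_lim.
have phi0 k := (h k).1; have psiphi k := (h k).2.
exists phi, psi => P.
have eigen mu k : nu k = mu -> exists r, [/\ is_eigenvalue P mu,
    alg_mult P mu r & ([set k | nu k = mu] #= `I_r)%card].
  move=> kmu; have [D [Du Ds D1]] := eigenvalue_index mu.
  have [K [Ku Ks]] := nu_index mu.
  have [G [C Gs]] := reduced_resolvent hdot d0 l_sep hspec e_on A_coord mu.
  have kK : k \in K by rewrite Ks kmu.
  case sK : (size K) => [|r]; first by case: (K) sK kK.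
  exists r.+1; have [h1 h2] := root_chain hdot hA d0 l_sep e_d e_on e_complete A_coord
    bB c_lim phi0 psiphi Du Ds D1 Ku Ks Gs sK.
  split=> //; rewrite -sK; apply: card_uniq_list => // j; rewrite Ks.
  by split => /eqP.
have resolv mu : (forall k, nu k != mu) -> resolvent_set P mu.
  move=> hmu; have [D [Du Ds D1]] := eigenvalue_index mu.
  have [K [Ku Ks]] := nu_index mu.
  have [G [C Gs]] := reduced_resolvent hdot d0 l_sep hspec e_on A_coord mu.
  have sK : size K = 0%N.
    case: K {Ku} Ks => // k K /(_ k); rewrite mem_head => /esym.
    by rewrite (negPf (hmu k)).
  have := resolvent_of_not_nu hdot hA d0 l_sep e_d e_on e_complete A_coord
    bB c_lim phi0 psiphi Du Ds D1 Ku Ks Gs sK.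
  exact.
have spec_nu mu : spectrum P mu -> exists k, nu k = mu.
  move=> smu; apply: contrapT => hmu; apply: smu; apply: resolv => k.
  by apply/eqP => kmu; apply: hmu; exists k.
have eig_spec mu : is_eigenvalue P mu -> spectrum P mu.
  move=> [x [dx x0 Px]] [_ [M hM]]; have := hM x dx.
  have -> : op_shift P mu x = 0 by rewrite -[LHS]/(P x - mu *: x) Px subrr.
  rewrite normr0 mulr0 normr_le0.
  by rewrite (negPf x0).
split.
- by move=> mu /spec_nu[k /eigen[r []]].
- apply/seteqP; split=> mu; first by move=> /spec_nu[k <-]; exists k.
  by move=> [k _ kmu]; have [r [h1 _ _]] := eigen mu k kmu; exact: eig_spec.
- move=> mu /eig_spec/spec_nu[k kmu]; have [r [_ h1 h2]] := eigen mu k kmu.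
  by exists r.
Qed.

End SequenceIndexed.

(** * Transfer from the index set [I] to the natural numbers *)

Unset Implicit Arguments.

Theorem theorem4p1 (R : realType) (H : completeNormedModType R[i])
  (dot : {dot H for (@Num.conj R[i])}) (hdot : hilbert_form dot)
  (hsep : separable H) (hinf : infinite_dim H)
  (A : operator H) (hA : self_adjoint dot A)
  (I : set int) (hI : index_set dot A I)
  (lambda : int -> R)
  (hincr : forall n m : int, I n -> I m -> n < m -> lambda n < lambda m)
  (hspec : spectrum A = [set (lambda n)%:C | n in I])
  (hsimple : simple_discrete_spectrum A)
  (hgap : 0 < inf [set `|lambda (n + 1) - lambda n| | n in I])
  (nu : nat -> R[i])
  (hnu : exists e : int -> nat, set_bij I [set: nat] e /\
     (\esum_(n in I) (Normc.normc (nu (e n) - (lambda n)%:C))%:E < +oo)%E) :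
  exists phi psi : H,
    let B := rank_one_perturbation dot A phi psi in
    [/\ (forall mu, spectrum B mu -> is_eigenvalue B mu),
        spectrum B = range nu &
        forall mu, is_eigenvalue B mu ->
          exists m : nat, alg_mult B mu m /\ ([set k | nu k = mu] #= `I_m)%card].
Proof.
have I_succ n : I n -> I (n + 1).
  by case: hI => [[_ ->]|[_ [_ ->]]]//= n0; rewrite addr_ge0.
have [e [[_ e_inj e_surj] efin]] := hnu.
(* [h] inverts [e]: the eigenvalue paired with [nu k] is [lambda (h k)]. *)
have /choice[h hh] : forall k, exists n, I n /\ e n = k.
  by move=> k; have [n In enk] := e_surj k Logic.I; exists n.
have hI' k : I (h k) by have [] := hh k.
have eh k : e (h k) = k by have [] := hh k.
have h_inj : injective h by move=> j k jk; rewrite -(eh j) -(eh k) jk.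
pose d := inf [set `|lambda (n + 1) - lambda n| | n in I].
have step n : I n -> d <= lambda (n + 1) - lambda n.
  move=> In; have lt : lambda n < lambda (n + 1).
    by apply: hincr => //; [exact: I_succ|rewrite ltrDl].
  rewrite -[leRHS]ger0_norm; last by rewrite subr_ge0 ltW.
  by apply: ge_inf; [exists 0 => _ [m _ <-]|exists n].
(* The gap concerns neighbours; monotonicity extends it to all pairs, a form that survives the
   re-enumeration by [h], which destroys the order. *)
have sep n m : I n -> I m -> n < m -> d <= lambda m - lambda n.
  move=> In Im nm; apply: le_trans (step n In) _; rewrite lerD2r.
  have : n + 1 <= m by rewrite lezD1.
  rewrite le_eqVlt => /orP[/eqP ->//|lt]; apply/ltW/hincr => //; exact: I_succ.
have l_sep j k : j != k -> d <= `|lambda (h j) - lambda (h k)|.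
  move=> jk; have := inj_eq h_inj j k; rewrite (negPf jk) => /negbT.
  rewrite neq_lt => /orP[lt|lt].
    by rewrite distrC (le_trans _ (ler_norm _))// sep.
  by rewrite (le_trans _ (ler_norm _))// sep.
have spec : spectrum A = [set (lambda (h k))%:C | k in [set: nat]].
  rewrite hspec; apply/seteqP; split=> z [n In <-]; last by exists (h n).
  exists (e n) => //; congr ((lambda _)%:C); apply: e_inj; rewrite ?inE//.
have [B bB] : exists B, forall n,
    \sum_(0 <= k < n) normc (nu (e (h k)) - (lambda (h k))%:C) <= B.
  apply: (esum_bound_iota (f := fun n => normc (nu (e n) - (lambda n)%:C)) _ h_inj hI' efin).
  by move=> n; exact: normc_ge0.
apply: (@sequence_rank_one_spectrum _ _ _ hdot _ hA (lambda \o h) d hgap l_sep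
  spec hsimple nu B) => n.
rewrite (eq_bigr (fun k => normc (nu (e (h k)) - (lambda (h k))%:C)))// => k _.
by rewrite eh.
Qed.
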